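(* Let $p\in\mathbb Z\setminus\{0\}$ and $r\in\mathbb C$. Then the $q$-character of the irreducible highest weight module $L[p,r]$ is $$\operatorname{char}_q L[p,r]=q^{h_{p,r}}\,\bigl(1-q^{|p|/2}\bigr)\prod_{k=1}^{\infty}\frac{(1+q^{k-1/2})^2}{(1-q^k)^2}\qquad\text{if } p \text{ is odd},$$ $$\operatorname{char}_q L[p,r]=q^{h_{p,r}}\,\bigl(1-q^{|p|}\bigr)\prod_{k=1}^{\infty}\frac{(1+q^{k-1/2})^2}{(1-q^k)^2}\qquad\text{if } p \text{ is even}.$$
   Context: The $N=1$ Heisenberg-Virasoro algebra $\mathcal{SH}$ is the complex Lie superalgebra with even basis elements $L(n),\alpha(n)$ ($n\in\mathbb Z$), odd basis elements $G(n+\frac12),\Psi(n+\frac12)$ ($n\in\mathbb Z$), and even central elements $C_L,C_\alpha,C_{L,\alpha}$, with (super)commutators, for $m,n\in\mathbb Z$: $[\alpha(m),\alpha(n)]=\delta_{m+n,0}\,m\,C_\alpha$; $[L(m),\alpha(n)]=-n\,\alpha(m+n)-\delta_{m+n,0}(m^2+m)C_{L,\alpha}$; $[L(m),L(n)]=(m-n)L(m+n)+\delta_{m+n,0}\frac{m^3-m}{12}C_L$; $[\Psi(m+\frac12),\Psi(n+\frac12)]_+=\delta_{m+n+1,0}C_\alpha$; $[\alpha(m),\Psi(n+\frac12)]=0$; $[G(m+\frac12),G(n+\frac12)]_+=2L(m+n+1)+\delta_{m+n+1,0}\frac{m^2+m}{3}C_L$; $[L(m),G(n+\frac12)]=(\frac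 m2-n-\frac12)G(m+n+\frac12)$; $[\alpha(m),G(n+\frac12)]=m\,\Psi(m+n+\frac12)$; $[\Psi(m+\frac12),L(n)]=\frac{2m+n+1}{2}\Psi(m+n+\frac12)$; $[\Psi(m+\frac12),G(n+\frac12)]_+=\alpha(m+n+1)+2m\,\delta_{m+n+1,0}C_{L,\alpha}$. Let $\mathcal{SH}^{+}$ be the span of $L(n),\alpha(n),G(n-\frac12),\Psi(n-\frac12)$, $n\ge1$. Fix $c_L,c_{L,\alpha}\in\mathbb C$ with $c_{L,\alpha}\ne0$. For $h,h_\alpha\in\mathbb C$, $V(h,h_\alpha)$ denotes the Verma module: the universal $\mathcal{SH}$-module generated by a vector $v$ with $\mathcal{SH}^+v=0$, $L(0)v=hv$, $\alpha(0)v=h_\alpha v$, on which $C_L$ acts by $c_L$, $C_\alpha$ by $0$ and $C_{L,\alpha}$ by $c_{L,\alpha}$. $L(h,h_\alpha)$ denotes its simple quotient. For $p,r\in\mathbb C$ put $$h_{p,r}=(1-p^2)\frac{c_L-3}{24}-rp,\qquad L[p,r]=L\bigl(h_{p,r},(1+p)c_{L,\alpha}\bigr).$$ The $q$-character of a module $M$ with $L(0)$ diagonalizable and finite-dimensional eigenspaces $M_\lambda$ is $\operatorname{char}_qM=\sum_\lambda \dim(M_\lambda)q^\lambda$. *)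

(* Defs.v *)
From HB Require Import structures.
From mathcomp Require Import all_boot all_order all_algebra.
From mathcomp Require Import reals.
From mathcomp Require Import finmap.
From mathcomp Require Import complex.
From mathcomp Require Import monalg.

Set Implicit Arguments.
Unset Strict Implicit.
Unset Printing Implicit Defensive.

Import Order.TTheory GRing.Theory Num.Theory.

Local Open Scope ring_scope.

(** * The N=1 Heisenberg-Virasoro algebra *)

(* [iG n] and [iPsi n] stand for G(n+1/2) and Psi(n+1/2). *)
Inductive shIdx : Type :=
  | iL of int | iA of int | iG of int | iPsi of int | iCL | iCA | iCLA.

Definition shIdx_code (x : shIdx) : nat * int :=
  match x with
  | iL n => (0%N, n) | iA n => (1%N, n) | iG n => (2%N, n) | iPsi n => (3%N, n)
  | iCL => (4%N, 0) | iCA => (5%N, 0) | iCLA => (6%N, 0)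
  end.

Definition shIdx_decode (c : nat * int) : shIdx :=
  match c with
  | (0%N, n) => iL n | (1%N, n) => iA n | (2%N, n) => iG n | (3%N, n) => iPsi n
  | (4%N, _) => iCL | (5%N, _) => iCA | _ => iCLA
  end.

Lemma shIdx_codeK : cancel shIdx_code shIdx_decode.
Proof. by case. Qed.

HB.instance Definition _ := Choice.copy shIdx (can_type shIdx_codeK).

Definition sh_odd (x : shIdx) : bool :=
  match x with iG _ | iPsi _ => true | _ => false end.

Section Algebra.
Variable R : realType.
Local Notation C := R[i].

Definition SH : lmodType C := {malg C[shIdx]}.

Definition sh_basis (x : shIdx) : SH := << 1 *g x >>.

(* delta_{k,0} *)
Local Notation dlt k := ((k == 0 :> int)%:R : C).
Local Notation "n %:C" := ((n : int)%:~R : C).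

Definition brAA (m n : int) : SH := (dlt (m + n) * m%:C) *: sh_basis iCA.
Definition brLA (m n : int) : SH :=
  - n%:C *: sh_basis (iA (m + n))
  - (dlt (m + n) * (m%:C ^+ 2 + m%:C)) *: sh_basis iCLA.
Definition brLL (m n : int) : SH :=
  (m - n)%:C *: sh_basis (iL (m + n))
  + (dlt (m + n) * ((m%:C ^+ 3 - m%:C) / 12%:R)) *: sh_basis iCL.
Definition brPsiPsi (m n : int) : SH := dlt (m + n + 1) *: sh_basis iCA.
Definition brGG (m n : int) : SH :=
  2%:R *: sh_basis (iL (m + n + 1))
  + (dlt (m + n + 1) * ((m%:C ^+ 2 + m%:C) / 3%:R)) *: sh_basis iCL.
Definition brLG (m n : int) : SH :=
  (m%:C / 2%:R - n%:C - 2%:R^-1) *: sh_basis (iG (m + n)).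
Definition brAG (m n : int) : SH := m%:C *: sh_basis (iPsi (m + n)).
Definition brPsiL (m n : int) : SH :=
  ((2 * m + n + 1)%:C / 2%:R) *: sh_basis (iPsi (m + n)).
Definition brPsiG (m n : int) : SH :=
  sh_basis (iA (m + n + 1))
  + (dlt (m + n + 1) * (2%:R * m%:C)) *: sh_basis iCLA.

Definition sh_bracket_idx (x y : shIdx) : SH :=
  match x, y with
  | iA m, iA n => brAA m n
  | iL m, iL n => brLL m n
  | iG m, iG n => brGG m n
  | iPsi m, iPsi n => brPsiPsi m n
  | iL m, iA n => brLA m n     | iA n, iL m => - brLA m n
  | iL m, iG n => brLG m n     | iG n, iL m => - brLG m n
  | iA m, iG n => brAG m n     | iG n, iA m => - brAG m n
  | iPsi m, iL n => brPsiL m n | iL n, iPsi m => - brPsiL m n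
  | iPsi m, iG n => brPsiG m n | iG n, iPsi m => brPsiG m n
  | iA _, iPsi _ => 0          | iPsi _, iA _ => 0
  | iCL, _ => 0 | iCA, _ => 0 | iCLA, _ => 0
  | _, iCL => 0 | _, iCA => 0 | _, iCLA => 0
  end.

Definition sh_bracket (x y : SH) : SH :=
  \sum_(a <- msupp x) \sum_(b <- msupp y) (x@_a * y@_b) *: sh_bracket_idx a b.

Lemma sh_bracket_basis a b :
  sh_bracket (sh_basis a) (sh_basis b) = sh_bracket_idx a b.
Proof.
rewrite /sh_bracket !msuppU oner_eq0 !big_seq_fset1 !mcoeffUU mulr1.
exact: scale1r.
Qed.

Definition sh_homog (b : bool) (x : SH) : Prop :=
  forall k, k \in msupp x -> sh_odd k = b.

(* L(n), alpha(n), G(n-1/2), Psi(n-1/2) with n >= 1 *)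
Definition sh_pos (k : shIdx) : bool :=
  match k with
  | iL n | iA n => 1 <= n
  | iG n | iPsi n => 1 <= n + 1
  | _ => false
  end.

Definition SHplus (x : SH) : Prop := forall k, k \in msupp x -> sh_pos k.

(** * Modules *)

Record shModule := ShModule {
  sh_carrier :> lmodType C;
  sh_act : SH -> sh_carrier -> sh_carrier;
  sh_act_linl : forall a x y v,
    sh_act (a *: x + y) v = a *: sh_act x v + sh_act y v;
  sh_act_linr : forall x a v w,
    sh_act x (a *: v + w) = a *: sh_act x v + sh_act x w;
  sh_act_bracket : forall b c x y v, sh_homog b x -> sh_homog c y ->
    sh_act (sh_bracket x y) v =
      sh_act x (sh_act y v) - (-1) ^+ (b && c) *: sh_act y (sh_act x v)
}.

Definition sh_hom (V W : shModule) (f : V -> W) : Prop :=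
  (forall a v w, f (a *: v + w) = a *: f v + f w) /\
  (forall x v, f (sh_act x v) = sh_act x (f v)).

Definition sh_submodule (V : shModule) (S : V -> Prop) : Prop :=
  [/\ S 0, forall a v w, S v -> S w -> S (a *: v + w)
    & forall x v, S v -> S (sh_act x v)].

Definition sh_generated (V : shModule) (v : V) : Prop :=
  forall S : V -> Prop, sh_submodule S -> S v -> forall w, S w.

Definition sh_simple (V : shModule) : Prop :=
  (exists v : V, v != 0) /\
  forall S : V -> Prop, sh_submodule S ->
    (exists2 v, S v & v != 0) -> forall w, S w.

(* [V] has level (cL, 0, cLA); [v] satisfies the highest weight conditions,
   but may be zero. *)
Definition sh_hwv (cL cLA h ha : C) (V : shModule) (v : V) : Prop :=
  [/\ [/\ forall w : V, sh_act (sh_basis iCL) w = cL *: w,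
          forall w : V, sh_act (sh_basis iCA) w = 0
        & forall w : V, sh_act (sh_basis iCLA) w = cLA *: w],
      forall x, SHplus x -> sh_act x v = 0,
      sh_act (sh_basis (iL 0)) v = h *: v
    & sh_act (sh_basis (iA 0)) v = ha *: v].

Definition is_verma (cL cLA h ha : C) (V : shModule) (v : V) : Prop :=
  [/\ sh_hwv cL cLA h ha v,
      sh_generated v
    & forall (W : shModule) (w : W), sh_hwv cL cLA h ha w ->
        exists f : V -> W,
          [/\ sh_hom f, f v = w
            & forall g : V -> W, sh_hom g -> g v = w -> g =1 f]].

(* [M], with the projection [pi], is a simple quotient of the Verma module. *)
Definition is_simple_quotient (V M : shModule) (pi : V -> M) : Prop :=
  [/\ sh_hom pi, forall m, exists v, pi v = m & sh_simple M].

(** * q-characters *)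

Definition has_dim (V : lmodType C) (S : V -> Prop) (d : nat) : Prop :=
  exists e : 'I_d -> V,
    [/\ forall i, S (e i),
        forall c : 'I_d -> C, \sum_i c i *: e i = 0 -> forall i, c i = 0
      & forall v, S v -> exists c : 'I_d -> C, v = \sum_i c i *: e i].

Definition L0_eigen (M : shModule) (lam : C) (m : M) : Prop :=
  sh_act (sh_basis (iL 0)) m = lam *: m.

Definition L0_diagonalizable (M : shModule) : Prop :=
  forall m : M, exists (n : nat) (lam : 'I_n -> C) (y : 'I_n -> M),
    (forall i, L0_eigen (lam i) (y i)) /\ m = \sum_i y i.

(* A formal sum of q^lam with lam complex is encoded by its coefficient
   function. *)
Definition has_qchar (M : shModule) (chi : C -> int) : Prop :=
  L0_diagonalizable M /\
  forall lam, exists2 d : nat, has_dim (@L0_eigen M lam) d & chi lam = d%:Z.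

Definition h_pr (cL : C) (p : int) (r : C) : C :=
  (1 - p%:C ^+ 2) * ((cL - 3%:R) / 24%:R) - r * p%:C.

End Algebra.

(** * Formal power series with integer coefficients *)

(* The variable is t = q^(1/2). *)
Definition fps := nat -> int.

Definition fps_one : fps := fun n => (n == 0%N)%:R.
Definition fps_mono (m : nat) : fps := fun n => (n == m)%:R.
Definition fps_add (f g : fps) : fps := fun n => f n + g n.
Definition fps_sub (f g : fps) : fps := fun n => f n - g n.
Definition fps_mul (f g : fps) : fps :=
  fun n => \sum_(i < n.+1) f i * g (n - i)%N.

(* The inverse of a series with constant coefficient 1, computed
   coefficient by coefficient; see [fps_mulVf]. *)
Fixpoint fps_inv_seq (f : fps) (n : nat) : seq int :=
  if n is m.+1 then
    let s := fps_inv_seq f m in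
    rcons s ((m == 0%N)%:R - \sum_(i < m) s`_i * f (m - i)%N)
  else [::].
Definition fps_inv (f : fps) : fps := fun n => (fps_inv_seq f n.+1)`_n.

Fixpoint fps_prod_upto (u : nat -> fps) (K : nat) : fps :=
  if K is k.+1 then fps_mul (fps_prod_upto u k) (u K) else fps_one.

(* The product of u 1, u 2, ... when u k = 1 modulo t^k for all k: the n-th
   coefficient of the partial products is constant from rank n on; see
   [fps_prod_lim]. *)
Definition fps_prod (u : nat -> fps) : fps := fun n => fps_prod_upto u n n.

(* (1 + q^(k-1/2))^2 / (1 - q^k)^2, for k >= 1 *)
Definition char_factor (k : nat) : fps :=
  let a := fps_add fps_one (fps_mono (2 * k - 1)) in
  let b := fps_sub fps_one (fps_mono (2 * k)) in
  fps_mul (fps_mul a a) (fps_inv (fps_mul b b)).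

(* q^h f(q^(1/2)): the coefficient of q^lam is that of t^n in f when
   lam = h + n/2, and 0 when there is no such n; see [qseriesE] and
   [qseries_out]. *)
Definition qseries (R : realType) (h : R[i]) (f : fps) : R[i] -> int :=
  fun lam =>
    let n := Num.truncn (2%:R * complex.Re (lam - h)) in
    if lam == h + n%:R / 2%:R then f n else 0.

Lemma size_fps_inv_seq f n : size (fps_inv_seq f n) = n.
Proof. by elim: n => //= n IHn; rewrite size_rcons IHn. Qed.

Lemma nth_fps_inv_seq f n i : (i < n)%N -> (fps_inv_seq f n)`_i = fps_inv f i.
Proof.
elim: n => // n IHn; rewrite ltnS leq_eqVlt => /orP[/eqP -> // | lt_in].
by rewrite [fps_inv_seq _ _]/= nth_rcons size_fps_inv_seq lt_in IHn.
Qed.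

Lemma fps_invE f n :
  fps_inv f n = (n == 0%N)%:R - \sum_(i < n) fps_inv f i * f (n - i)%N.
Proof.
rewrite {1}/fps_inv [fps_inv_seq _ _]/= nth_rcons size_fps_inv_seq ltnn eqxx.
congr (_ - _); apply: eq_bigr => i _; congr (_ * _).
exact: nth_fps_inv_seq.
Qed.

Lemma fps_mulVf f : f 0%N = 1 -> fps_mul (fps_inv f) f =1 fps_one.
Proof.
move=> f0 n; rewrite /fps_mul big_ord_recr /= subnn f0 mulr1.
by rewrite [fps_inv f n]fps_invE addrC subrK.
Qed.

Definition fps_near_one (k : nat) (f : fps) : Prop :=
  forall i, (i < k)%N -> f i = fps_one i.

Lemma fps_mul_near_one k f g n :
  fps_near_one k g -> (n < k)%N -> fps_mul f g n = f n.
Proof.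
move=> g1 lt_nk; rewrite /fps_mul big_ord_recr /= subnn g1 ?mulr1; last first.
  exact: leq_ltn_trans lt_nk.
rewrite big1 ?add0r // => i _; rewrite g1 /fps_one.
  by rewrite subn_eq0 leqNgt ltn_ord mulr0.
exact: leq_ltn_trans (leq_subr _ _) lt_nk.
Qed.

Lemma fps_prod_lim u n K : (forall k, (0 < k)%N -> fps_near_one k (u k)) ->
  (n <= K)%N -> fps_prod_upto u K n = fps_prod u n.
Proof.
move=> u1; elim: K => [|K IHK]; first by rewrite leqn0 => /eqP ->.
rewrite leq_eqVlt => /orP[/eqP -> // | lt_nK] /=.
by rewrite (fps_mul_near_one _ (u1 K.+1 isT)) ?IHK.
Qed.

Lemma fps_inv_near_one k f : fps_near_one k f -> fps_near_one k (fps_inv f).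
Proof.
move=> f1 n lt_nk; rewrite fps_invE big1 ?subr0 // => i _.
rewrite f1 /fps_one; first by rewrite subn_eq0 leqNgt ltn_ord mulr0.
exact: leq_ltn_trans (leq_subr _ _) lt_nk.
Qed.

Lemma char_factor_near_one k : (0 < k)%N -> fps_near_one k (char_factor k).
Proof.
move=> k_gt0.
have mulf f g : fps_near_one k f -> fps_near_one k g ->
    fps_near_one k (fps_mul f g).
  by move=> f1 g1 i ik; rewrite (fps_mul_near_one _ g1) ?f1.
have mono m i : (k <= m)%N -> (i < k)%N -> fps_mono m i = 0.
  by move=> km ik; rewrite /fps_mono ltn_eqF // (leq_trans ik).
have le_k2 : (k <= 2 * k)%N by rewrite mul2n -addnn leq_addr.
have le_k1 : (k <= 2 * k - 1)%N.
  by rewrite mul2n -addnn -addnBA // leq_addr.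
have a1 : fps_near_one k (fps_add fps_one (fps_mono (2 * k - 1))).
  by move=> i ik; rewrite /fps_add mono // addr0.
have b1 : fps_near_one k (fps_sub fps_one (fps_mono (2 * k))).
  by move=> i ik; rewrite /fps_sub mono // subr0.
by rewrite /char_factor; apply: (mulf); [exact: mulf|apply/fps_inv_near_one/mulf].
Qed.

Lemma qseriesE (R : realType) (h : R[i]) f n :
  qseries h f (h + n%:R / 2%:R) = f n.
Proof.
rewrite /qseries addrAC subrr add0r.
have -> : 2%:R * complex.Re (n%:R / 2%:R : R[i]) = n%:R.
  have -> : (n%:R / 2%:R : R[i]) = ((n%:R / 2%:R : R)%:C)%C.
    by rewrite rmorphM fmorphV !rmorph_nat.
  by rewrite /= mulrC divfK // pnatr_eq0.
by rewrite natrK eqxx.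
Qed.

Lemma qseries_out (R : realType) (h : R[i]) f lam :
  (forall n, lam <> h + n%:R / 2%:R) -> qseries h f lam = 0.
Proof. by move=> out; rewrite /qseries; case: eqP => // /out. Qed.

(* Main.v *)
(** Write A(2n) = L(n), A(2n+1) = G(n+1/2), B(2n) = alpha(n) and
B(2n+1) = Psi(n+1/2).  As C_alpha = 0, the B's supercommute, and [A(d), B(e)] is
a multiple of B(d+e), except that [A(d), B(-d)] is a scalar w(d): with
c = c_{L,alpha}, one finds w(2n) = n c (p - n) and w(d) = c (p - d) for d odd.  So
w vanishes, among the nonzero d, exactly at d = 2p and, when p is odd, at d = p.

In the simple module, take the coefficient of the highest weight vector v in
A(m') B(l') A(-l) B(-m) v, where l, m, l', m' are multisets of positive integers
with distinct odd parts.  Ordered by the lengths of l and m, this pairing is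
triangular, and its diagonal entries are products of nonzero integers, of values
w(-d) with d in l and of values w(d) with d in m.  Let p > 0.  Then the vectors
A(-l) B(-m) v with m avoiding the zeros of w are linearly independent.  They also
span: an A(d) with w(d) = 0, placed leftmost, sends the vectors B(-m) v to vectors
without component along v, so that, in each degree, the B(-m) v are separated by as
many functionals as there are m avoiding the zeros of w.  The case p < 0 follows by
passing to the contragredient dual, which replaces w(d) by w(-d) up to sign.
Counting pairs (l, m) yields the product formula; for p odd, the factor lost is
(1 - q^p) / (1 + q^(p/2)) = 1 - q^(p/2). *)

Require Import Defs.
From HB Require Import structures.
From mathcomp Require Import all_boot all_order all_algebra.
From mathcomp Require Import boolp functions.
From mathcomp Require Import reals.
From mathcomp Require Import complex.
From mathcomp Require Import finmap monalg.
From mathcomp Require Import zify ring.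

Set Implicit Arguments.
Unset Strict Implicit.
Unset Printing Implicit Defensive.

Import Order.TTheory GRing.Theory Num.Theory.

Local Open Scope ring_scope.

(** * Linear spans and reordering of words *)

(** The argument sees the algebra only through the shape of its relations: apart from the signs, the
    weights and [w], the structure constants of a [rep] are arbitrary. This is what lets p < 0 reuse
    p > 0. The dual acts by the plain transposes of A(-d) and B(-d), which satisfy relations of the
    same shape with other constants, so the dual need not be a module over the original algebra.

    Triangularity holds because positive modes consume letters. A positive B annihilates words in
    the negative B's, so it has to meet an A; a positive A applied to such a word removes at most
    one B. Up to terms with fewer A's or more B's, which do not contribute, positive modes therefore
    act as derivations of a supercommutative algebra.

    Simplicity enters as the statement that a submodule without component along v is zero. The mode
    B(0) = alpha(0) acts as the scalar h_alpha: it is absorbed in w, and stability of a subspace is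
    asked for the other modes. *)

Section Span.
Variables (K : fieldType) (T : lmodType K).
Implicit Types (S : T -> Prop).

Inductive lspan S : T -> Prop :=
  | lspan0 : lspan S 0
  | lspanC a x y : S x -> lspan S y -> lspan S (a *: x + y).

Lemma lspan_mem S x : S x -> lspan S x.
Proof. by move=> Sx; rewrite -[x]addr0 -[x in x + _]scale1r; apply: lspanC => //; left. Qed.

Lemma lspanD S x y : lspan S x -> lspan S y -> lspan S (x + y).
Proof.
elim=> [|a z t Sz _ IH] Sy; first by rewrite add0r.
by rewrite -addrA; apply: lspanC => //; apply: IH.
Qed.

Lemma lspanZ S a x : lspan S x -> lspan S (a *: x).
Proof.
elim=> [|b z t Sz _ IH]; first by rewrite scaler0; left.
by rewrite scalerDr scalerA; apply: lspanC.
Qed.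

Lemma lspanB S x y : lspan S x -> lspan S y -> lspan S (x - y).
Proof. by move=> Sx Sy; apply: lspanD => //; rewrite -scaleN1r; apply: lspanZ. Qed.

Lemma lspanP S a x y : lspan S x -> lspan S y -> lspan S (a *: x + y).
Proof. by move=> Sx Sy; apply: lspanD => //; apply: lspanZ. Qed.

Lemma lspan_sum S I (r : seq I) (P : pred I) (F : I -> T) :
  (forall i, P i -> lspan S (F i)) -> lspan S (\sum_(i <- r | P i) F i).
Proof. by move=> H; apply: big_ind => //; [left|apply: lspanD]. Qed.

Lemma lspan_bind S S' x : (forall y, S y -> lspan S' y) -> lspan S x -> lspan S' x.
Proof.
move=> H; elim=> [|a z t /H Sz _ IH]; first by left.
by apply: lspanP.
Qed.

Lemma lspan_sub S S' x : (forall y, S y -> S' y) -> lspan S x -> lspan S' x.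
Proof. by move=> H; apply: lspan_bind => y /H; apply: lspan_mem. Qed.

Lemma lspan_range (I : eqType) (r : seq I) (F : I -> T) (i0 : I) x :
  lspan (fun t => exists2 i, i \in r & t = F i) x ->
  exists c : 'I_(size r) -> K, x = \sum_k c k *: F (nth i0 r k).
Proof.
elim=> [|a z t [i ir ->] _ [c ->]].
  by exists (fun=> 0); rewrite big1 // => k _; rewrite scale0r.
have lt_ir : (index i r < size r)%N by rewrite index_mem.
exists (fun k => (if k == Ordinal lt_ir then a else 0) + c k).
under [RHS]eq_bigr => k _ do rewrite scalerDl.
rewrite big_split /=; congr (_ + _).
rewrite (bigD1 (Ordinal lt_ir)) //= eqxx nth_index // big1 ?addr0 // => k.
by move=> /negPf ->; rewrite scale0r.
Qed.

End Span.

Definition linear_map (K : fieldType) (T U : lmodType K) (f : T -> U) :=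
  forall a x y, f (a *: x + y) = a *: f x + f y.

Section Lin.
Variables (K : fieldType) (T U : lmodType K) (f : T -> U).
Hypothesis fl : linear_map f.

Lemma linear_map0 : f 0 = 0.
Proof. by have := fl (-1) 0 0; rewrite scaler0 addr0 scaleN1r addNr. Qed.
Lemma linear_mapD x y : f (x + y) = f x + f y.
Proof. by rewrite -{1}[x]scale1r fl scale1r. Qed.
Lemma linear_mapZ a x : f (a *: x) = a *: f x.
Proof. by rewrite -[_ *: x]addr0 fl linear_map0 addr0. Qed.
Lemma linear_mapN x : f (- x) = - f x.
Proof. by rewrite -scaleN1r linear_mapZ scaleN1r. Qed.
Lemma linear_mapB x y : f (x - y) = f x - f y.
Proof. by rewrite linear_mapD linear_mapN. Qed.
Lemma linear_map_sum I (r : seq I) (P : pred I) (F : I -> T) :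
  f (\sum_(i <- r | P i) F i) = \sum_(i <- r | P i) f (F i).
Proof. exact: (big_morph _ linear_mapD linear_map0). Qed.

Lemma lspan_lin S S' x : (forall y, S y -> lspan S' (f y)) -> lspan S x -> lspan S' (f x).
Proof.
move=> H; elim=> [|a z t Sz _ IH]; first by rewrite linear_map0; left.
by rewrite fl; apply: lspanP => //; apply: H.
Qed.
End Lin.

Definition word_act (I T : Type) (Y : I -> T -> T) (w : seq I) (t : T) : T := foldr Y t w.

Lemma word_act_cat (I T : Type) (Y : I -> T -> T) w1 w2 t :
  word_act Y (w1 ++ w2) t = word_act Y w1 (word_act Y w2 t).
Proof. exact: foldr_cat. Qed.

Lemma word_act_lin (K : fieldType) (T : lmodType K) I (Y : I -> T -> T) w :
  (forall i, linear_map (Y i)) -> linear_map (word_act Y w).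
Proof. by move=> Yl a x y; elim: w => //= i w ->; rewrite Yl. Qed.

(* Strict order on letters, except that an even letter may be repeated. *)
Definition lew (lt : rel nat) : rel nat :=
  fun i j => lt i j || (i == j) && ~~ odd i.

Section PBW.
Variables (K : numFieldType) (T : lmodType K) (Y : nat -> T -> T) (lt : rel nat).
Hypothesis Ylin : forall i, linear_map (Y i).
Hypothesis Ycomm : forall i j, (0 < i)%N -> (0 < j)%N ->
  exists c, forall t, Y i (Y j t) =
    (-1) ^+ (odd i && odd j) *: Y j (Y i t) + c *: Y (i + j)%N t.
Hypothesis lt_trans : transitive lt.
Hypothesis lt_tot : forall i j, [|| lt i j, i == j | lt j i].

Let pos (w : seq nat) := all (fun i => 0 < i)%N w.

Definition sorted_word w := sorted (lew lt) w.

Lemma lew_trans : transitive (lew lt).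
Proof.
move=> j i k /orP[ij|/andP[/eqP -> oj]] /orP[jk|/andP[/eqP <- ok]].
- by apply/orP; left; apply: lt_trans ij jk.
- by rewrite /lew ij.
- by rewrite /lew jk.
- by rewrite /lew eqxx oj orbT.
Qed.

(** Exchanging [i] with the head of [v] costs a commutator, in which the two letters merge into one.
    The merged words are no longer than [v], one letter less than [i :: v], which is what an
    induction on length can absorb. *)
Lemma straighten_insert t i v : (0 < i)%N -> pos v -> sorted_word v ->
  lspan (fun s => exists v', [/\ s = word_act Y v' t, sumn v' = (i + sumn v)%N, pos v'
        & (size v' <= size v)%N \/ sorted_word v' /\ perm_eq v' (i :: v)])
      (Y i (word_act Y v t)).
Proof.
move=> i0; elim: v => [|j v IH] /=.
  move=> _ _; apply: lspan_mem; exists [:: i]; rewrite /= i0; split=> //.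
  by right; split=> //; apply: perm_refl.
case/andP=> j0 pv sjv; have sv : sorted_word v by apply: path_sorted sjv.
case lij: (lew lt i j).
  apply: lspan_mem; exists [:: i, j & v]; rewrite /= i0 j0; split=> //.
  by right; rewrite /sorted_word /= lij; split=> //; apply: perm_refl.
have [c Yij] := Ycomm i0 j0.
have short : lspan (fun s => exists v', [/\ s = word_act Y v' t,
    sumn v' = (i + (j + sumn v))%N, pos v'
    & (size v' <= (size v).+1)%N \/ sorted_word v' /\ perm_eq v' [:: i, j & v]])
    (Y (i + j)%N (word_act Y v t)).
  apply: lspan_mem; exists ((i + j)%N :: v); split=> //=; first by rewrite addnA.
    by rewrite addn_gt0 i0.
  by left.
have /or3P[lt_ij|/eqP eij|lt_ji] := lt_tot i j.
- by rewrite /lew lt_ij in lij.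
- subst j; move: lij; rewrite /lew eqxx /= => /norP[_]; rewrite negbK => oi.
  (* An odd letter anticommutes with itself, so 2 Y_i^2 = c Y_(2i), and the square is replaced by a
     single letter. *)
  have := Yij (word_act Y v t); rewrite oi expr1 scaleN1r.
  move/eqP; rewrite addrC -subr_eq opprK -mulr2n -scaler_nat => /eqP Yii.
  have -> : Y i (Y i (word_act Y v t)) = (2%:R^-1 * c) *: Y (i + i)%N (word_act Y v t).
    by rewrite -scalerA -Yii scalerA mulVf ?scale1r // pnatr_eq0.
  exact: lspanZ.
rewrite Yij; apply: lspanP; last exact: lspanZ.
move: (IH pv sv); apply: (lspan_lin (Ylin j)) => s [v' [-> sum_v' pv' hv']].
apply: lspan_mem; exists (j :: v'); split=> //=.
- by rewrite sum_v' addnCA.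
- by rewrite j0.
case: hv' => [le_v'|[sv' pe]]; first by left.
right; split; last first.
  apply: (perm_trans (y := [:: j, i & v])); first by rewrite perm_cons.
  by apply/permPl; apply: (perm_catCA [:: j] [:: i] v).
rewrite /sorted_word /= path_sortedE; last exact: lew_trans.
apply/andP; split=> //; rewrite (perm_all _ pe) /= {1}/lew lt_ji /=.
by move: sjv; rewrite /sorted_word /= path_sortedE => [/andP[]|]; last exact: lew_trans.
Qed.

(** Insertion yields either sorted words or words short enough for the induction on length. The
    order is a parameter because the decreasing order gives the bases, while another one serves to
    bring chosen letters to the left. *)
Lemma straighten t w : pos w ->
  lspan (fun s => exists v, [/\ s = word_act Y v t, sumn v = sumn w, pos v,
         sorted_word v & (size v <= size w)%N]) (word_act Y w t).
Proof.
have [n] := ubnP (size w); elim: n w => // n IHn [|i w] /=.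
  by move=> _ _; apply: lspan_mem; exists [::].
rewrite ltnS => szw /andP[i0 pw].
have step v : pos v -> sorted_word v -> (size v <= size w)%N -> sumn v = sumn w ->
  lspan (fun s => exists v', [/\ s = word_act Y v' t, sumn v' = (i + sumn w)%N, pos v',
         sorted_word v' & (size v' <= (size w).+1)%N]) (Y i (word_act Y v t)).
  move=> pv sv szv sumv; move: (straighten_insert t i0 pv sv); apply: lspan_bind => s.
  case=> v' [-> sum_v' pv' [szv'|[sv' pe]]].
    have szv'w := leq_trans szv' szv.
    have := IHn v' (leq_ltn_trans szv'w szw) pv'.
    apply: lspan_sub => s' [v'' [-> sum'' pv'' sv'' sz'']]; exists v''; split=> //.
      by rewrite sum'' sum_v' sumv.
    by apply: leq_trans sz'' (leq_trans szv'w _).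
  apply: lspan_mem; exists v'; split=> //; first by rewrite sum_v' sumv.
  by rewrite (perm_size pe) /=.
move: (IHn w szw pw); apply: (lspan_lin (Ylin i)) => s [v [-> sumv pv sv szv]].
exact: step.
Qed.

End PBW.

Lemma lspan_false (K : fieldType) (T : lmodType K) (S : T -> Prop) x :
  (forall y, ~ S y) -> lspan S x -> x = 0.
Proof. by move=> nS; case=> // a y z /nS. Qed.

(** * Words in negative modes and the pairing *)

Definition sgn (K : numFieldType) (d e : int) : K := (-1) ^+ (odd `|d|%N && odd `|e|%N).

(* Modes are doubled, so that the parity of an index is that of the operator. *)
Record rep (K : numFieldType) := Rep {
  car :> lmodType K;
  opA : int -> car -> car;
  opB : int -> car -> car;
  cA : int -> int -> K;
  cz : int -> int -> K;
  cB : int -> int -> K;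
  cw : int -> K;
  opA_lin : forall d, linear_map (opA d);
  opB_lin : forall d, linear_map (opB d);
  opAA : forall d e t, opA d (opA e t) =
    sgn K d e *: opA e (opA d t) + cA d e *: opA (d + e) t
    + (if d + e == 0 then cz d e else 0) *: t;
  opAB : forall d e t, opA d (opB e t) = sgn K d e *: opB e (opA d t)
    + (if d + e == 0 then cw d *: t else cB d e *: opB (d + e) t);
  opBB : forall d e t, opB d (opB e t) = sgn K d e *: opB e (opB d t);
  opA0A : forall d t, opA 0 (opA d t) = opA d (opA 0 t) - (d%:~R / 2%:R) *: opA d t;
  opA0B : forall d t, opA 0 (opB d t) = opB d (opA 0 t) - (d%:~R / 2%:R) *: opB d t
}.

(** * An abstract pairing of annihilating and creating operators *)

Section Pairing.
Variables (K : numFieldType) (T : lmodType K) (X Y : nat -> T -> T).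
(** [N k] consists of the vectors that are negligible when [k] operators [X] remain to be applied;
    hence [Y] raises the index and [X] lowers it. *)
Variables (N : nat -> T -> Prop) (w : nat -> K) (t : T).
Hypothesis Xlin : forall e, linear_map (X e).
Hypothesis Ylin : forall i, linear_map (Y i).
Hypothesis N0 : forall k, N k 0.
Hypothesis NP : forall k a x y, N k x -> N k y -> N k (a *: x + y).
Hypothesis YN : forall k i x, (0 < i)%N -> N k x -> N k.+1 (Y i x).
Hypothesis XN : forall k e x, (0 < e)%N -> N k.+1 x -> N k (X e x).
Hypothesis Xt : forall e, (0 < e)%N -> X e t = 0.
Let pos (l : seq nat) := all (fun i => 0 < i)%N l.
Hypothesis XY : forall e i l, (0 < e)%N -> (0 < i)%N -> pos l ->
  let s := word_act Y l t in
  N (size l) (X e (Y i s) - (-1) ^+ (odd e && odd i) *: Y i (X e s)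
              - ((e == i)%:R * w e) *: s).

Lemma gtn_trans : transitive gtn.
Proof. by move=> j i k /= ji kj; apply: ltn_trans kj ji. Qed.

(* Modulo [N], the operator [X e] acts on words in the [Y i] as a derivation. *)
Lemma pairing_step e l : (0 < e)%N -> pos l -> sorted (lew gtn) l ->
  exists b, N (size l).-1 (X e (word_act Y l t)
    - ((-1) ^+ (odd e && b) * w e * (count_mem e l)%:R) *: word_act Y (rem e l) t).
Proof.
have ND k x y : N k x -> N k y -> N k (x + y).
  by move=> Nx Ny; rewrite -[x]scale1r; apply: NP.
move=> e0; elim: l => [|i l IH] /=.
  by move=> _ _; exists false; rewrite Xt // mulr0 scale0r subr0; apply: N0.
case/andP=> i0 pl sil; have sl := path_sorted sil.
have [b Nb] := IH pl sl.
set c := (-1) ^+ (odd e && b) * w e * (count_mem e l)%:R in Nb.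
(* [YN] turns [(size l).-1] into [size l] only for nonempty [l]; for the empty word both terms
   vanish. *)
have step2 : N (size l) (Y i (X e (word_act Y l t)) - c *: Y i (word_act Y (rem e l) t)).
  have := Nb; case: l pl {IH sil sl Nb} @c => [|j l] pl c Nb /=.
    by rewrite Xt // (linear_map0 (Ylin i)) /c mulr0 scale0r subr0.
  by rewrite -(linear_mapZ (Ylin i)) -(linear_mapB (Ylin i)); apply: (YN i0 Nb).
have key := NP ((-1) ^+ (odd e && odd i)) step2 (XY e0 i0 pl).
have [eie|nie] := eqVneq i e; last first.
  exists (odd i (+) b); rewrite /= add0n.
  congr (N _ _): key; rewrite eq_sym (negPf nie) mul0r scale0r subr0 scalerBr.
  rewrite addrC subrKA; congr (_ - _).
  rewrite scalerA /c !mulrA; congr ((_ * _ * _) *: _).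
  rewrite -signr_addb; congr (_ ^+ _).
  by case: (odd e); case: (odd i); case: (b).
subst i; exists false; rewrite andbF expr0 mul1r.
congr (N _ _): key; rewrite eqxx mul1r andbb scalerBr /= natrD mulrDr mulr1 scalerDl.
(* If [e] occurs again in the tail, sortedness makes it the head of the tail and even, so the sign
   is trivial; otherwise its multiplicity there is zero. *)
have -> : (-1) ^+ odd e *: (c *: Y e (word_act Y (rem e l) t)) =
          (w e * (count_mem e l)%:R) *: word_act Y l t.
  rewrite /c; have [el|/count_memPn ->] := boolP (e \in l); last first.
    by rewrite !mulr0 !scale0r scaler0.
  case: l el sil {sl pl IH step2 Nb} @c => // j l.
  have [<- _ |nej] := eqVneq j e.
    rewrite /= {1}/lew /= ltnn eqxx /= => /andP[oj _]; rewrite (negPf oj) /=.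
    by rewrite expr0 scale1r mul1r ?eqxx.
  rewrite inE eq_sym (negPf nej) /= => el /andP[lej].
  rewrite path_sortedE; last exact/lew_trans/gtn_trans.
  case/andP=> /allP/(_ _ el); rewrite {}/lew in lej *.
  by rewrite (negPf nej) (eq_sym e) (negPf nej) /= in lej *; lia.
by rewrite addrC addrAC subrKA addrAC opprD addrA.
Qed.

(** The last operator of [es] acts first and deletes one copy of its letter, with the multiplicity
    as a factor. Nothing survives unless [es] exhausts [l]; if it does, the multiplicities are
    nonzero in characteristic zero. *)
Lemma pairing_value es l : pos es -> pos l -> sorted (lew gtn) l ->
  size es = size l ->
  exists c, [/\ N 0 (word_act X es (word_act Y l t) - c *: t),
    ~~ perm_eq es l -> c = 0 &
    perm_eq es l -> all (fun e => w e != 0) l -> c != 0].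
Proof.
elim/last_ind: es l => [|es e IH] l.
  by case: l => // *; exists 1; rewrite scale1r subrr oner_eq0; split.
rewrite /pos all_rcons size_rcons => /andP[e0 pes] pl sl szl.
have [b Nb] := pairing_step e0 pl sl.
have XesN k x : N (size es + k)%N x -> N k (word_act X es x).
  elim: {IH szl} es pes k x => [|f es IHe] //= /andP[f0 pes] k x Nx.
  by apply: XN => //; apply: IHe => //; rewrite addnS.
rewrite -szl /= in Nb; set c1 := (_ * _ * _) in Nb.
have Wl := word_act_lin es Xlin.
have N1 : N 0 (word_act X es (X e (word_act Y l t))
    - c1 *: word_act X es (word_act Y (rem e l) t)).
  by rewrite -(linear_mapZ Wl) -(linear_mapB Wl); apply: XesN; rewrite addn0.
rewrite -cats1 word_act_cat /=.
have [el|nel] := boolP (e \in l); last first.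
  exists 0; split=> //; last first.
    by move=> /perm_mem/(_ e); rewrite mem_cat inE eqxx orbT (negPf nel).
  by move: N1; rewrite /c1 (count_memPn nel) mulr0 !scale0r !subr0.
have sr : sorted (lew gtn) (rem e l).
  by apply: (subseq_sorted _ (rem_subseq e l) sl); apply/lew_trans/gtn_trans.
have pr : pos (rem e l) by apply/allP => x /mem_rem/(allP pl).
have szr : size es = size (rem e l) by rewrite size_rem // -szl.
have [c2 [Nc2 c20 c2n0]] := IH _ pes pr sr szr.
have pE : perm_eq (es ++ [:: e]) l = perm_eq es (rem e l).
  by rewrite cats1 perm_rcons (permPr (perm_to_rem el)) perm_cons.
exists (c1 * c2); split; last 1 first.
- rewrite pE => pe wl.
  rewrite !mulf_neq0 ?signr_eq0 ?pnatr_eq0 -?lt0n -?has_count ?has_pred1 //.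
    exact: (allP wl).
  by apply: c2n0 => //; apply/allP => x /mem_rem/(allP wl).
- have := NP c1 Nc2 N1; congr (N _ _).
  by rewrite scalerBr scalerA addrC subrKA.
by rewrite pE => /c20 ->; rewrite mulr0.
Qed.

End Pairing.

Section RepTheory.
Variables (K : numFieldType) (M : rep K).
Implicit Types (t : M) (w : seq (bool * nat)).

Lemma sgn_sq d e : sgn K d e * sgn K d e = 1.
Proof. by rewrite /sgn -expr2 sqrr_sign. Qed.

Lemma opBA d e t : opB e (opA d t) = sgn K d e *: opA d (opB e t)
  - sgn K d e *: (if d + e == 0 then cw M d *: t else cB M d e *: opB (d + e) t).
Proof.
by rewrite opAB scalerDr scalerA sgn_sq scale1r addrK.
Qed.

Definition neg_op (i : bool * nat) : M -> M :=
  if i.1 then opB (- i.2%:Z) else opA (- i.2%:Z).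
Definition numA w := count (fun i => ~~ i.1) w.
Definition numB w := count fst w.
Definition level w := sumn (map snd w).
Definition pos_word w := all (fun i : bool * nat => 0 < i.2)%N w.

Lemma neg_op_lin i : linear_map (neg_op i).
Proof. by rewrite /neg_op; case: i.1; [apply: opB_lin|apply: opA_lin]. Qed.

Lemma opA_neg d t : d <= 0 -> opA d t = neg_op (false, `|d|%N) t.
Proof. by move=> d0; rewrite /neg_op /=; congr (opA _ _); lia. Qed.

Lemma opB_neg d t : d <= 0 -> opB d t = neg_op (true, `|d|%N) t.
Proof. by move=> d0; rewrite /neg_op /=; congr (opB _ _); lia. Qed.

Definition neg_span (P : seq (bool * nat) -> Prop) (R : M -> Prop) : M -> Prop :=
  lspan (fun t => exists w r, [/\ pos_word w, P w, R r & t = word_act neg_op w r]).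

Lemma neg_span_cons (P Q : seq (bool * nat) -> Prop) R i t : (0 < i.2)%N ->
  (forall w, pos_word w -> P w -> Q (i :: w)) -> neg_span P R t -> neg_span Q R (neg_op i t).
Proof.
move=> i0 PQ; apply: (lspan_lin (neg_op_lin i)) => s [w [r [pw Pw Rr ->]]].
by apply: lspan_mem; exists (i :: w), r; split=> //=; [rewrite i0|apply: PQ].
Qed.

Lemma neg_span_sub (P Q : seq (bool * nat) -> Prop) R t :
  (forall w, pos_word w -> P w -> Q w) -> neg_span P R t -> neg_span Q R t.
Proof.
move=> PQ; apply: lspan_sub => s [w [r [pw Pw Rr ->]]].
by exists w, r; split=> //; apply: PQ.
Qed.

Lemma neg_span_word (P : seq (bool * nat) -> Prop) (R : M -> Prop) w r :
  pos_word w -> P w -> R r -> neg_span P R (word_act neg_op w r).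
Proof. by move=> *; apply: lspan_mem; exists w, r. Qed.

Section Stable.
Variable R : M -> Prop.
Hypothesis RA : forall (d : int) t, 0 <= d -> R t -> lspan R (opA d t).
Hypothesis RB : forall (d : int) t, 0 < d -> R t -> lspan R (opB d t).

Let N := neg_span (fun=> True) R.

Let RN t : lspan R t -> N t.
Proof. by apply: lspan_sub => s Rs; exists [::], s. Qed.

(** Moving a mode past the first letter leaves single modes, of either sign, on a shorter word, so
    all modes are treated in one induction. [opB 0] never arises: where it would, the relation gives
    the scalar [cw]. *)
Let wordN w r : pos_word w -> R r ->
  (forall d, N (opA d (word_act neg_op w r))) /\
  (forall d : int, d != 0 -> N (opB d (word_act neg_op w r))).
Proof.
elim: w => [|i w IH] pw Rr.
  split=> d; first case: (leP 0 d) => d0; first by apply/RN/RA.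
    apply: lspan_mem; exists [:: (false, `|d|%N)], r; split=> //=; first by lia.
    by rewrite opA_neg // ltW.
  case: (ltP 0 d) => d0 dn0; first by apply/RN/RB.
  apply: lspan_mem; exists [:: (true, `|d|%N)], r; split=> //=; first by lia.
  by rewrite opB_neg.
have /andP[i0 pw'] : (0 < i.2)%N && pos_word w by [].
have [IA IB] := IH pw' Rr.
have Ns : N (word_act neg_op w r) by apply: neg_span_word.
have Ni s : N s -> N (neg_op i s) by apply: neg_span_cons.
split=> d /=; last move=> dn0.
  case: (leP 0 d) => d0; last first.
    apply: lspan_mem; exists ((false, `|d|%N) :: i :: w), r; split=> //=.
      by rewrite i0; apply/andP; split=> //; lia.
    by rewrite opA_neg // ltW.
  case: i Ni i0 {pw} => -[] j Ni /= j0; rewrite /neg_op /=.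
    rewrite opAB; apply: lspanP; first exact: (Ni _ (IA d)).
    case: ifP => [_|/negbT nz]; first exact: lspanZ.
    by apply/lspanZ/IB.
  rewrite opAA; apply: lspanD; first apply: lspanP; first exact: (Ni _ (IA d)).
    by apply/lspanZ/IA.
  exact: lspanZ.
case: (ltP 0 d) => d0; last first.
  apply: lspan_mem; exists ((true, `|d|%N) :: i :: w), r; split=> //=.
    by rewrite i0; apply/andP; split=> //; lia.
  by rewrite opB_neg.
case: i Ni i0 {pw} => -[] j Ni /= j0; rewrite /neg_op /=.
  by rewrite opBB; apply: lspanZ; exact: (Ni _ (IB d dn0)).
rewrite opBA; apply: lspanB; apply: lspanZ; first exact: (Ni _ (IB d dn0)).
case: ifP => [_|/negbT nz]; first exact: lspanZ.
by apply/lspanZ/IB.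
Qed.

Lemma neg_span_stableA d t : neg_span (fun=> True) R t -> neg_span (fun=> True) R (opA d t).
Proof.
apply: (lspan_lin (@opA_lin _ M d)) => s [w [r [pw _ Rr ->]]].
by case: (wordN pw Rr) => H _; apply: H.
Qed.

Lemma neg_span_stableB (d : int) t : d != 0 ->
  neg_span (fun=> True) R t -> neg_span (fun=> True) R (opB d t).
Proof.
move=> d0; apply: (lspan_lin (@opB_lin _ M d)) => s [w [r [pw _ Rr ->]]].
by case: (wordN pw Rr) => _ H; apply: H.
Qed.

End Stable.

Lemma weight_word w t lam : opA 0 t = lam *: t ->
  opA 0 (word_act neg_op w t) = (lam + (level w)%:R / 2%:R) *: word_act neg_op w t.
Proof.
move=> tl; elim: w => [|i w IH] /=; first by rewrite mul0r addr0.
have -> : opA 0 (neg_op i (word_act neg_op w t)) =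
    neg_op i (opA 0 (word_act neg_op w t)) + (i.2%:R / 2%:R) *: neg_op i (word_act neg_op w t).
  by rewrite /neg_op; case: i.1; rewrite (opA0A, opA0B) mulrNz mulNr scaleNr opprK.
rewrite IH (linear_mapZ (neg_op_lin i)) -scalerDl; congr (_ *: _).
by rewrite /level /= natrD; field.
Qed.

Lemma eigen_indep (lam : nat -> K) N (s : nat -> M) : injective lam ->
  (forall m, opA 0 (s m) = lam m *: s m) -> \sum_(m < N) s m = 0 ->
  forall m, (m < N)%N -> s m = 0.
Proof.
move=> linj; elim: N s => // N IH s es.
rewrite big_ord_recr /= => s0.
have s'0 m : (m < N)%N -> s m = 0.
  move=> mN; have /eqP : (lam m - lam N) *: s m = 0.
    apply: (IH (fun m => (lam m - lam N) *: s m)) => // [k|].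
      by rewrite (linear_mapZ (@opA_lin _ M 0)) es !scalerA mulrC.
    have := congr1 (fun x => opA 0 x - lam N *: x) s0.
    rewrite /= (linear_map0 (@opA_lin _ M 0)) scaler0 subrr.
    rewrite (linear_mapD (@opA_lin _ M 0)) es scalerDr opprD addrACA subrr addr0.
    rewrite (linear_map_sum (@opA_lin _ M 0)) scaler_sumr -sumrB => {2}<-.
    by apply: eq_bigr => k _; rewrite es scalerBl.
  rewrite scaler_eq0 subr_eq0 => E.
  by case/orP: E => [/eqP/linj E|/eqP //]; rewrite E ltnn in mN.
move=> m; rewrite ltnS leq_eqVlt => /orP[/eqP ->|]; last exact: s'0.
by rewrite -s0 big1 ?add0r // => k _; apply: s'0.
Qed.

(** * Positive modes on words over a vector that they annihilate *)

Section Killed.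
Variable u : M.
Hypothesis uA : forall d : int, 0 < d -> opA d u = 0.
Hypothesis uB : forall d : int, 0 < d -> opB d u = 0.

Definition hw_span (P : seq (bool * nat) -> bool) : M -> Prop := neg_span P (eq u).

(** A positive B passes through the B's and annihilates [u], so only meeting an A contributes. The
    result is a scalar or a negative B, with one A lost and no B lost, or a positive B that has to
    meet a further A. *)
Lemma posB_word (e : nat) w : (0 < e)%N -> pos_word w ->
  hw_span (fun w' => (numA w' < numA w)%N &&
      (((numA w').+1 == numA w) ==> (numB w <= numB w')%N))
    (opB e%:Z (word_act neg_op w u)).
Proof.
elim: w e => [|[[] f] w IH] e e0 //=.
- by move=> _; rewrite uB; [left|lia].
- case/andP=> /= f0 pw; rewrite {1}/neg_op /= opBB; apply: lspanZ.
  apply: (@neg_span_cons _ _ _ (true, f) _ _ _ (IH e e0 pw)) => //=.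
case/andP=> /= f0 pw; rewrite {1}/neg_op /= opBA; apply: lspanB; apply: lspanZ.
  apply: (@neg_span_cons _ _ _ (false, f) _ _ _ (IH e e0 pw)) => //=.
case: ifP => [_|ne]; apply: lspanZ.
  by apply: neg_span_word => //; rewrite /numA /numB /=; lia.
case: (ltnP f e) => fe.
  have -> : - f%:Z + e%:Z = (e - f)%N by lia.
  have ef0 : (0 < e - f)%N by lia.
  by apply: (neg_span_sub _ (IH _ ef0 pw)) => w' pw'; rewrite /numA /numB /=; lia.
have -> : - f%:Z + e%:Z = - (f - e)%N%:Z by lia.
apply: (@neg_span_word _ _ ((true, (f - e)%N) :: w) u) => //=.
  by apply/andP; split=> //; lia.
by rewrite /numA /numB /=; lia.
Qed.

(* Negative operators supercommute on the graded pieces of this filtration, as the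
   bracket of two A's, or of an A and a B, has fewer A's. *)
Definition filK l j := hw_span (fun w => (numA w < l)%N || (numA w == l) && (j <= numB w)%N).

Lemma filK0 l j : filK l j 0.
Proof. by left. Qed.

Lemma filK_B l j (e : nat) t : (0 < e)%N -> filK l.+1 j t -> filK l j (opB e%:Z t).
Proof.
move=> e0; move=> Kt; apply: (lspan_lin (@opB_lin _ M _) _ Kt); clear Kt.
move=> s [w [_ [pw Pw <- ->]]]; apply: (neg_span_sub _ (posB_word e0 pw)) => w' _.
by move: Pw; clear; lia.
Qed.

Lemma filK_B0 j (e : nat) t : (0 < e)%N -> filK 0 j t -> opB e%:Z t = 0.
Proof.
move=> e0 Kt; apply: (@lspan_false _ _ (fun _ : M => False)); first by move=> _ [].
apply: (lspan_lin (@opB_lin _ M _) _ Kt) => s [w [_ [pw Pw <- ->]]].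
have := posB_word e0 pw; apply: lspan_sub => x [w' [_ [_ Pw' _ _]]].
by move: Pw Pw'; clear; lia.
Qed.

(** A positive A meeting a negative B gives a scalar, another negative B, or a positive B, which
    kills the rest of the word. Hence at most one B is lost. *)
Lemma posA_word (d : nat) w : (0 < d)%N -> pos_word w -> numA w = 0%N ->
  hw_span (fun w' => (numA w' == 0) && (numB w <= (numB w').+1)%N)
    (opA d%:Z (word_act neg_op w u)).
Proof.
move=> d0; elim: w => [|[[] f] w IH] //=; first by rewrite uA; [left|lia].
case/andP=> /= f0 pw w0; have {}w0 : numA w = 0%N by [].
have Kw : filK 0 0 (word_act neg_op w u) by apply: neg_span_word; rewrite // w0.
rewrite {1}/neg_op /= opAB; apply: lspanP.
  by apply: (@neg_span_cons _ _ _ (true, f) _ _ _ (IH pw w0)).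
case: ifP => [_|ne]; apply: lspanZ.
  by apply: neg_span_word => //; rewrite w0 /numB /=; lia.
case: (ltnP f d) => fd.
  have -> : d%:Z - f%:Z = (d - f)%N by lia.
  by rewrite (filK_B0 _ Kw); [left|lia].
have -> : d%:Z - f%:Z = - (f - d)%N%:Z by lia.
apply: (@neg_span_word _ _ ((true, (f - d)%N) :: w) u) => //=.
  by apply/andP; split=> //; lia.
by rewrite /numA /= -/(numA w) w0 /numB /=; lia.
Qed.

Lemma filK_A j (d : nat) t : (0 < d)%N -> filK 0 j.+1 t -> filK 0 j (opA d%:Z t).
Proof.
move=> d0; move=> Kt; apply: (lspan_lin (@opA_lin _ M _) _ Kt); clear Kt.
move=> s [w [_ [pw Pw <- ->]]].
have w0 : numA w = 0%N by move: Pw; clear; lia.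
apply: (neg_span_sub _ (posA_word d0 pw w0)) => w' _.
by move: Pw; clear; lia.
Qed.

Lemma filK_A0 (d : nat) t : (0 < d)%N -> filK 0 0 t -> filK 0 0 (opA d%:Z t).
Proof.
move=> d0; move=> Kt; apply: (lspan_lin (@opA_lin _ M _) _ Kt); clear Kt.
move=> s [w [_ [pw Pw <- ->]]].
have w0 : numA w = 0%N by move: Pw; clear; lia.
apply: (neg_span_sub _ (posA_word d0 pw w0)) => w' _.
by move: Pw; clear; lia.
Qed.

Lemma filK_sub l j l' j' t : (l <= l')%N -> (l < l')%N || (j' <= j)%N ->
  filK l j t -> filK l' j' t.
Proof. by move=> le_l le_j; apply: neg_span_sub => w _; lia. Qed.

Definition Am (i : nat) : M -> M := opA (- i%:Z).
Definition Bm (i : nat) : M -> M := opB (- i%:Z).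
Definition Ap (i : nat) : M -> M := opA i%:Z.
Definition Bp (i : nat) : M -> M := opB i%:Z.

Lemma filK_nA l j i t : (0 < i)%N -> filK l j t -> filK l.+1 j (Am i t).
Proof. by move=> i0; apply: (@neg_span_cons _ _ _ (false, i)). Qed.

Lemma filK_nB l j i t : (0 < i)%N -> filK l j t -> filK l j.+1 (Bm i t).
Proof. by move=> i0; apply: (@neg_span_cons _ _ _ (true, i)). Qed.

Definition mono (l m : seq nat) : M := word_act Am l (word_act Bm m u).
Definition all_pos (l : seq nat) := all (fun i => 0 < i)%N l.

Lemma mono_word l m :
  mono l m = word_act neg_op (map (pair false) l ++ map (pair true) m) u.
Proof.
rewrite word_act_cat /mono; elim: l => [|i l IH] /=; last by rewrite -IH.
by elim: m => //= i m ->.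
Qed.

Lemma mono_stats l m (w := map (pair false) l ++ map (pair true) m) :
  all_pos l -> all_pos m -> [/\ pos_word w, numA w = size l, numB w = size m
    & level w = (sumn l + sumn m)%N].
Proof.
move=> pl pm; rewrite /w /pos_word /numA /numB /level all_cat !count_cat map_cat sumn_cat.
rewrite !all_map !count_map -!map_comp !map_id; split=> //.
- by apply/andP.
- by rewrite (eq_count (a2 := predT)) // count_predT
     (eq_count (a2 := pred0)) // count_pred0 addn0.
- by rewrite (eq_count (a2 := pred0)) // count_pred0
     (eq_count (a2 := predT)) // count_predT.
Qed.

Lemma filK_mono l m : all_pos l -> all_pos m -> filK (size l) (size m) (mono l m).
Proof.
move=> pl pm; rewrite mono_word; have [pw eA eB _] := mono_stats pl pm.
by apply: neg_span_word => //; rewrite eA eB eqxx leqnn orbT.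
Qed.

Lemma weight_mono h l m : opA 0 u = h *: u -> all_pos l -> all_pos m ->
  opA 0 (mono l m) = (h + (sumn l + sumn m)%:R / 2%:R) *: mono l m.
Proof.
move=> u0 pl pm; rewrite mono_word; have [pw _ _ <-] := mono_stats pl pm.
exact: weight_word.
Qed.

Lemma filK_Bs k l j es t : all_pos es -> size es = k -> filK (k + l) j t ->
  filK l j (word_act Bp es t).
Proof.
elim: es k l => [|e es IH] k l /=; first by move=> _ <-.
by case/andP=> e0 pes <- Kt; apply: filK_B => //; apply: IH pes erefl _; rewrite addnS.
Qed.

Lemma filK_As j k es t : all_pos es -> (size es + k <= j)%N -> filK 0 j t ->
  filK 0 k (word_act Ap es t).
Proof.
elim: es k => [|e es IH] k /=.
  by move=> _ le_kj; apply: filK_sub.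
case/andP=> e0 pes le_kj Kt; apply: filK_A => //; apply: IH => //.
by rewrite addnS.
Qed.

Lemma filK_Bs0 k j es t : all_pos es -> (k < size es)%N -> filK k j t ->
  word_act Bp es t = 0.
Proof.
elim: es => //= e es IH /andP[e0 pes]; rewrite ltnS leq_eqVlt => /orP[/eqP ek|lt_k] Kt.
  by apply: (filK_B0 (j := j)) => //; apply: (filK_Bs (k := k)) => //; rewrite addn0.
by rewrite IH // /Bp (linear_map0 (@opB_lin _ M _)).
Qed.

Lemma signAm i e : sgn K (- i%:Z) e%:Z = (-1) ^+ (odd e && odd i).
Proof. by rewrite /sgn abszN !absz_nat andbC. Qed.

Lemma signAp d i : sgn K d%:Z (- i%:Z) = (-1) ^+ (odd d && odd i).
Proof. by rewrite /sgn abszN !absz_nat. Qed.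

(** Each positive B removes an A, while the B's of [m] are spectators. Words with more than [size m]
    B's are negligible: [size m] positive A's leave at least one B in them, and such words have no
    component along [u]. *)
Lemma pairing_AB es l m : all_pos es -> all_pos l -> all_pos m -> sorted (lew gtn) l ->
  size es = size l ->
  exists c, [/\ filK 0 (size m).+1 (word_act Bp es (mono l m) - c *: word_act Bm m u),
    ~~ perm_eq es l -> c = 0 &
    perm_eq es l -> all (fun e : nat => cw M (- e%:Z) != 0) l -> c != 0].
Proof.
move=> pes pl pm sl szl.
(* The weight is the scalar term of [opBA] at d = -e, where the sign of the pair (-e, e) is
   (-1)^e. *)
have [||||||||c [Nc c0 cn0]] := @pairing_value K M Bp Am
  (fun k => filK k (size m).+1) (fun e => - ((-1) ^+ odd e * cw M (- e%:Z)))
  (word_act Bm m u) _ _ _ _ _ _ _ _ es l pes pl sl szl.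
- by move=> e; apply: opB_lin.
- by move=> e; apply: opA_lin.
- by move=> k; apply: filK0.
- by move=> k a x y; apply: lspanP.
- by move=> k i x; apply: filK_nA.
- by move=> k e x; apply: filK_B.
- by move=> e e0; apply: (filK_B0 (j := size m)) => //; apply: (filK_mono (l := [::])).
- move=> e i l' e0 i0 pl' s.
  have Ks : filK (size l') (size m) s by apply: filK_mono.
  rewrite /Bp /Am opBA signAm [X in X - _]addrAC subrr add0r.
  have [->|nie] := eqVneq e i.
    rewrite addNr eqxx mul1r andbb scaleNr opprK scalerA addNr; exact: filK0.
  rewrite mul0r scale0r subr0 ifF; last by lia.
  rewrite -scaleNr; do 2 apply: lspanZ.
  case: (ltnP i e) => ie.
    have -> : - i%:Z + e%:Z = (e - i)%N by lia.
    have ei0 : (0 < e - i)%N by lia.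
    move: Ks; rewrite /s -/(mono l' m) mono_word.
    have [pw eA eB _] := mono_stats pl' pm => _.
    by apply: (neg_span_sub _ (posB_word ei0 pw)) => w' _; rewrite eA; lia.
  have -> : - i%:Z + e%:Z = - (i - e)%N%:Z by lia.
  by apply: filK_nB Ks; lia.
exists c; split=> // pe wl; apply: cn0 => //; apply/allP => e el /=.
by rewrite oppr_eq0 mulf_eq0 signr_eq0 /=; apply: (allP wl).
Qed.

Lemma pairing_BA es m : all_pos es -> all_pos m -> sorted (lew gtn) m ->
  size es = size m ->
  exists c, [/\ filK 0 1 (word_act Ap es (word_act Bm m u) - c *: u),
    ~~ perm_eq es m -> c = 0 &
    perm_eq es m -> all (fun e : nat => cw M e%:Z != 0) m -> c != 0].
Proof.
move=> pes pl sl szl.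
apply: (@pairing_value K M Ap Bm (fun k => filK 0 k.+1) (fun e => cw M e%:Z)) => //.
- by move=> e; apply: opA_lin.
- by move=> e; apply: opB_lin.
- by move=> k; apply: filK0.
- by move=> k a x y; apply: lspanP.
- by move=> k i x; apply: filK_nB.
- by move=> k e x; apply: filK_A.
- by move=> e e0; apply: uA.
move=> e i m' e0 i0 pm' s.
have Ks : filK 0 (size m') s by apply: (filK_mono (l := [::])).
rewrite /Ap /Bm opAB signAp [X in X - _]addrAC subrr add0r.
have [->|nie] := eqVneq e i.
  rewrite subrr eqxx mul1r subrr; exact: filK0.
rewrite mul0r scale0r subr0 ifF; last by lia.
apply: lspanZ; case: (ltnP i e) => ie.
  have -> : e%:Z - i%:Z = (e - i)%N by lia.
  by rewrite (filK_B0 _ Ks); [left|lia].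
have -> : e%:Z - i%:Z = - (i - e)%N%:Z by lia.
by apply: filK_nB Ks; lia.
Qed.

(** * The pairing given by the component along the highest weight vector *)

Section Functional.
Variable eps : M -> K.
Hypothesis eps_lin : linear_map (eps : M -> K^o).
Hypothesis epsA : forall (d : int) t, d < 0 -> eps (opA d t) = 0.
Hypothesis epsB : forall (d : int) t, d < 0 -> eps (opB d t) = 0.
Hypothesis eps_u : eps u = 1.

Lemma eps_filK t : filK 0 1 t -> eps t = 0.
Proof.
elim=> [|a x y [w [_ [pw Pw <- ->]]] _ IH]; first exact: (linear_map0 eps_lin).
rewrite eps_lin IH addr0; case: w pw Pw => [|[[] i] w] //= /andP[i0 _] _.
by rewrite /neg_op /= epsB ?scaler0 //; lia.
Qed.

(** More positive B's than A's annihilate the vector. With equally many, too few positive A's leave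
    only words that contain a negative B. *)
Lemma pairing_zero l' m' l m : all_pos l' -> all_pos m' -> all_pos l -> all_pos m ->
  (size l < size l')%N || (size l == size l') && (size m' < size m)%N ->
  eps (word_act Ap m' (word_act Bp l' (mono l m))) = 0.
Proof.
move=> pl' pm' pl pm; have Kt := filK_mono pl pm.
have Al := word_act_lin m' (fun i => @opA_lin _ M i%:Z).
case/orP=> [lt_l|/andP[/eqP szl lt_m]].
  by rewrite (filK_Bs0 pl' lt_l Kt) (linear_map0 Al) (linear_map0 eps_lin).
apply: eps_filK; apply: (filK_As (j := size m)) => //; first by rewrite addn1.
by apply: (filK_Bs (k := size l)) => //; rewrite addn0.
Qed.

Lemma pairing_diag l' m' l m : all_pos l' -> all_pos m' -> all_pos l -> all_pos m ->
  sorted (lew gtn) l -> sorted (lew gtn) m ->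
  size l' = size l -> size m' = size m ->
  all (fun e : nat => cw M (- e%:Z) != 0) l -> all (fun e : nat => cw M e%:Z != 0) m ->
  (eps (word_act Ap m' (word_act Bp l' (mono l m))) != 0) = perm_eq l' l && perm_eq m' m.
Proof.
move=> pl' pm' pl pm sl sm szl szm wl wm.
have [c1 [K1 c1z c1n]] := pairing_AB pl' pl pm sl szl.
have [c2 [K2 c2z c2n]] := pairing_BA pm' pm sm szm.
have Al := word_act_lin m' (fun i => @opA_lin _ M i%:Z).
have -> : eps (word_act Ap m' (word_act Bp l' (mono l m))) = c1 * c2.
  rewrite -[word_act Bp _ _](subrK (c1 *: word_act Bm m u))
    (linear_mapD Al) (linear_mapD eps_lin).
  rewrite [X in X + _]eps_filK ?add0r; last first.
    by apply: (filK_As (j := (size m).+1)) => //; rewrite szm addn1.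
  rewrite (linear_mapZ Al) (linear_mapZ eps_lin); congr (_ * _).
  rewrite -[word_act Ap _ _](subrK (c2 *: u)) (linear_mapD eps_lin) (eps_filK K2) add0r.
  by rewrite (linear_mapZ eps_lin) eps_u; apply: mulr1.
rewrite mulf_eq0 negb_or; congr (_ && _).
  case: (boolP (perm_eq l' l)) => [/c1n/(_ wl)->//|/c1z->]; by rewrite eqxx.
case: (boolP (perm_eq m' m)) => [/c2n/(_ wm)->//|/c2z->]; by rewrite eqxx.
Qed.

Lemma lew_perm_eq l l' : sorted (lew gtn) l -> sorted (lew gtn) l' ->
  perm_eq l l' -> l = l'.
Proof.
have sub : subrel (lew gtn) geq.
  by move=> i j; rewrite /lew /= => /orP[/ltnW|/andP[/eqP -> _]].
move=> /(sub_sorted sub) sl /(sub_sorted sub) sl'; apply: sorted_eq sl sl'.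
  by move=> j i k /= ji kj; apply: leq_trans kj ji.
by move=> i j; rewrite /= andbC => /anti_leq.
Qed.

(** Among the indices with nonzero coefficient, take one with longest [l] and, among those, with
    shortest [m]. Tested against its own pair, every other such term vanishes, by length or because
    sorted words with the same letters coincide. The test pairs are those of [r] itself, so the
    matrix is square and the result can be used to solve linear systems. *)
Lemma mono_indep (r : seq (seq nat * seq nat)) (c : 'I_(size r) -> K) : uniq r ->
  (forall p, p \in r ->
    [/\ all_pos p.1, all_pos p.2, sorted (lew gtn) p.1 & sorted (lew gtn) p.2]) ->
  (forall p, p \in r -> all (fun e : nat => cw M (- e%:Z) != 0) p.1 /\
                        all (fun e : nat => cw M e%:Z != 0) p.2) ->
  let F i := nth ([::], [::]) r i in
  (forall i : 'I_(size r), let p := F i in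
    \sum_k c k * eps (word_act Ap p.2 (word_act Bp p.1 (mono (F k).1 (F k).2))) = 0) ->
  forall i, c i = 0.
Proof.
move=> ur rP rw F H i; apply/eqP; apply/negPn/negP => ci.
have Fr (k : 'I_(size r)) : F k \in r by apply: mem_nth.
pose sz1 (k : 'I_(size r)) := size (F k).1; pose sz2 (k : 'I_(size r)) := size (F k).2.
have [k1 ck1 max1] := arg_maxnP (P := fun k => c k != 0) sz1 ci.
have Pk1 : (c k1 != 0) && (sz1 k1 == sz1 k1) by rewrite eqxx andbT.
have [k /andP[ck /eqP szk] min2] :=
  arg_minnP (P := fun k => (c k != 0) && (sz1 k == sz1 k1)) sz2 Pk1.
have [p1 p2 s1 s2] := rP _ (Fr k); have [w1 w2] := rw _ (Fr k).
have := H k; rewrite /= (bigD1 k) //= big1 => [/eqP|k' nk].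
  rewrite addr0 mulf_eq0 (negPf ck) /=; apply/negP.
  by rewrite pairing_diag // !perm_refl.
have [/eqP -> | ck'] := boolP (c k' == 0); first by rewrite mul0r.
have [p1' p2' s1' s2'] := rP _ (Fr k'); have [w1' w2'] := rw _ (Fr k').
have le1 := max1 _ ck'; have le2 := min2 k'; rewrite ck' /= in le2.
move: (szk) le1 le2; rewrite /sz1 /sz2 => szk1 le1 le2.
have [eq1|ne1] := eqVneq (size (F k').1) (size (F k1).1); last first.
  by rewrite pairing_zero ?mulr0 //; apply/orP; left; rewrite szk1 ltn_neqAle ne1.
have [eq2|ne2] := eqVneq (size (F k').2) (size (F k).2); last first.
  rewrite pairing_zero ?mulr0 //; apply/orP; right.
  by rewrite eq1 szk1 eqxx ltn_neqAle eq_sym ne2 /= le2 // eq1.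
apply/eqP; rewrite mulf_eq0 (negPf ck') /= -[_ == 0]negbK.
rewrite pairing_diag // ?szk1 ?eq1 ?eq2 //.
apply/negP => /andP[pe1 pe2].
have e1 := lew_perm_eq s1 s1' pe1; have e2 := lew_perm_eq s2 s2' pe2.
have eF : F k = F k' by move: e1 e2; case: (F k) (F k') => [? ?] [? ?] /= -> ->.
by move/eqP: eF; rewrite nth_uniq // => /eqP/val_inj ek; rewrite ek eqxx in nk.
Qed.

End Functional.
End Killed.
End RepTheory.

(** * Partitions with distinct odd parts *)

Section Parts.
Local Open Scope nat_scope.

Fixpoint bwords (k : nat) (A : seq nat) : seq (seq nat) :=
  if k is k'.+1 then [::] :: [seq a :: s | a <- A, s <- bwords k' A] else [:: [::]].

Lemma mem_bwords k A s : (s \in bwords k A) = (size s <= k) && all (mem A) s.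
Proof.
elim: k s => [|k IH] [|a s] //=.
rewrite inE /= ltnS andbCA -IH.
apply/allpairsP/andP => [[[b t] /= [bA tw [-> ->]]]//|[aA sw]].
by exists (a, s).
Qed.

(* [lew gtn] allows repetitions of even parts only. *)
Definition parts (P : pred nat) (N n : nat) : seq (seq nat) :=
  undup [seq s <- bwords n (iota 1 n) |
    [&& sorted (lew gtn) s, all (fun i => [&& 0 < i, i <= N & P i]) s & sumn s == n]].

Lemma leq_sumn s i : i \in s -> i <= sumn s.
Proof.
elim: s => //= j s IH; rewrite inE => /orP[/eqP ->|/IH]; first exact: leq_addr.
by move=> le_i; apply: leq_trans le_i (leq_addl _ _).
Qed.

Lemma size_leq_sumn s : all (fun i => 0 < i) s -> size s <= sumn s.
Proof. by elim: s => //= i s IH /andP[i0 /IH]; lia. Qed.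

Lemma mem_parts P N n s : (s \in parts P N n) =
  [&& sorted (lew gtn) s, all (fun i => [&& 0 < i, i <= N & P i]) s & sumn s == n].
Proof.
rewrite mem_undup mem_filter mem_bwords; apply: andb_idr => /and3P[_ al /eqP <-].
have pos : all (fun i => 0 < i) s by apply: sub_all al => i /and3P[].
rewrite size_leq_sumn //=.
apply/allP => i si /=; rewrite mem_iota add1n ltnS leq_sumn // andbT.
by have /and3P[] := allP al i si.
Qed.

Lemma parts_uniq P N n : uniq (parts P N n).
Proof. exact: undup_uniq. Qed.

Lemma size_parts_ext P N P' N' n : parts P N n =i parts P' N' n ->
  size (parts P N n) = size (parts P' N' n).
Proof. by move=> E; apply/perm_size/uniq_perm; rewrite ?parts_uniq. Qed.

Lemma size_parts_bound P N n : n <= N -> size (parts P N n) = size (parts P n n).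
Proof.
move=> nN; apply: size_parts_ext => s; rewrite !mem_parts.
case: eqP => [sn|]; last by rewrite !andbF.
congr [&& _, _ & _]; apply: eq_in_all => i /leq_sumn; rewrite sn => le_in.
by rewrite le_in (leq_trans le_in nN).
Qed.

Lemma size_parts0 P n : size (parts P 0 n) = (n == 0).
Proof.
have := @uniq_perm _ (parts P 0 n) (if n == 0 then [:: [::]] else [::]).
rewrite parts_uniq => /(_ isT) E; rewrite (perm_size (E _ _)).
- by case: ifP.
- by case: ifP.
move=> s; rewrite mem_parts; case: s => [|i s] /=.
  by rewrite eq_sym; case: eqP.
by rewrite leqn0; case: i => [|i] /=; rewrite ?andbF; case: ifP.
Qed.

(** Split according to whether the part N+1 occurs. If it does, it stands first and is removed; the
    remainder may contain it again only when it is even. *)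
Lemma size_partsS P N n : size (parts P N.+1 n) = size (parts P N n) +
  (if P N.+1 && (N.+1 <= n) then
     size (parts P (if odd N.+1 then N else N.+1) (n - N.+1)) else 0).
Proof.
set L := parts P N n; set c := _ && _.
set L' := parts P (if odd N.+1 then N else N.+1) (n - N.+1).
have -> : (if c then size L' else 0) =
    size (if c then [seq N.+1 :: s | s <- L'] else [::]).
  by case: c; rewrite ?size_map.
rewrite -size_cat; apply/perm_size/uniq_perm; first exact: parts_uniq.
  rewrite cat_uniq parts_uniq /=; apply/andP; split; last first.
    case: c => //; rewrite map_inj_uniq ?parts_uniq //.
    by move=> s t [].
  case: c => //; rewrite -all_predC; apply/allP => _ /mapP[s _ ->] /=.
  by rewrite mem_parts /= ltnn !andbF.
move=> s; rewrite mem_cat [in RHS]mem_parts [in LHS]mem_parts.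
case: s => [|i s] /=.
  suff /negbTE -> : [::] \notin (if c then [seq N.+1 :: s | s <- L'] else [::]).
    by rewrite orbF.
  by case: c => //; apply/negP => /mapP[].
have [->|niN] := eqVneq i N.+1; last first.
  have /negbTE -> : i :: s \notin (if c then [seq N.+1 :: s | s <- L'] else [::]).
    by case: c => //; apply/negP => /mapP[t _ [/eqP]]; rewrite (negPf niN).
  rewrite orbF.
  have -> : (i <= N.+1) = (i <= N) by rewrite leq_eqVlt (negPf niN).
  case: (leqP i N) => iN; last by rewrite !andbF.
  apply/and3P/and3P => -[pi /andP[ci al] sn]; split=> //; apply/andP; split=> //.
    apply/allP => j sj; have /and3P[j0 _ Pj] := allP al j sj; rewrite j0 Pj andbT /=.
    move: pi; rewrite path_sortedE; last exact/lew_trans/gtn_trans.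
    case/andP=> /allP/(_ _ sj); rewrite /lew /= => /orP[ji|/andP[/eqP <- _]] // _.
    exact: ltnW (leq_trans ji iN).
  by apply: sub_all al => j /and3P[-> jN ->]; rewrite (leqW jN).
rewrite ltnn !andbF /= /c leqnn /=; case PN: (P N.+1) => //=; last by rewrite !andbF.
rewrite path_sortedE; last exact/lew_trans/gtn_trans.
case: (leqP N.+1 n) => nN; last first.
  by apply/negbTE/negP => /and3P[_ _ /eqP]; lia.
rewrite mem_map; last by move=> ? ? [].
rewrite mem_parts -andbA.
have -> : (N.+1 + sumn s == n) = (sumn s == n - N.+1) by lia.
rewrite andbCA; congr (_ && _); rewrite !andbA; congr (_ && _).
rewrite -all_predI; apply: eq_all => j /=; rewrite /lew /=.
move: (odd N) (P j) => b q; rewrite [N.+1 == j]eq_sym.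
by case: b; case: q => /=; lia.
Qed.
End Parts.

(** * Bases of the homogeneous components *)

(* [opB 0] is left out: it comes from alpha(0), which acts as a scalar. *)
Definition stable (K : numFieldType) (M : rep K) (S : M -> Prop) : Prop :=
  [/\ S 0, forall a x y, S x -> S y -> S (a *: x + y),
      forall d x, S x -> S (opA d x)
    & forall (d : int) x, d != 0 -> S x -> S (opB d x)].

(* [hw_sep] expresses simplicity, in a form that is dual to [hw_gen]. *)
Record hwrep (K : numFieldType) := HwRep {
  hwr :> rep K;
  hwv : hwr;
  hwf : hwr -> K;
  hwt : K;
  hwb : K;
  hwB0 : forall x : hwr, opB 0 x = hwb *: x;
  hwf_lin : linear_map (hwf : hwr -> K^o);
  hwvA : forall d : int, 0 < d -> opA d hwv = 0;
  hwvB : forall d : int, 0 < d -> opB d hwv = 0;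
  hwv0 : opA 0 hwv = hwt *: hwv;
  hwfA : forall (d : int) x, d < 0 -> hwf (opA d x) = 0;
  hwfB : forall (d : int) x, d < 0 -> hwf (opB d x) = 0;
  hwf0 : forall x, hwf (opA 0 x) = hwt * hwf x;
  hwf_hwv : hwf hwv = 1;
  hw_gen : forall S : hwr -> Prop, stable S -> S hwv -> forall x, S x;
  hw_sep : forall S : hwr -> Prop, stable S -> (forall x, S x -> hwf x = 0) ->
    forall x, S x -> x = 0
}.

Lemma solve_square (K : fieldType) c (Q : 'I_c -> 'I_c -> K) :
  (forall a : 'I_c -> K, (forall i, \sum_k a k * Q i k = 0) -> forall k, a k = 0) ->
  forall y : 'I_c -> K, exists a : 'I_c -> K, forall i, \sum_k a k * Q i k = y i.
Proof.
move=> inj y; pose G : 'M_c := \matrix_(k, i) Q i k.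
have Gu : G \in unitmx.
  rewrite -row_free_unit; apply: inj_row_free => v vG; apply/rowP => k.
  rewrite mxE; apply: (inj (fun k => v 0 k)) => i.
  by have /rowP/(_ i) := vG; rewrite !mxE => H; rewrite -[RHS]H;
    apply: eq_bigr => j _; rewrite !mxE.
exists (fun k => ((\row_i y i) *m invmx G) 0 k) => i.
have /rowP/(_ i) := mulmxKV Gu (\row_i y i); rewrite !mxE => H; rewrite -[RHS]H.
by apply: eq_bigr => k _; rewrite !mxE.
Qed.

(** * Bases when the zeros of [w] lie at positive modes *)

Section Upper.
Variables (K : numFieldType) (M : hwrep K).

Definition levelspan (n : nat) : M -> Prop :=
  neg_span (fun w => level w = n) (eq (hwv M)).

Lemma word_gen (x : M) : neg_span (fun=> True) (eq (hwv M)) x.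
Proof.
apply: (hw_gen (S := neg_span (fun=> True) (eq (hwv M)))).
  have RA (d : int) t : 0 <= d -> hwv M = t -> lspan (eq (hwv M)) (opA d t).
    move=> d0 <-; case: (ltrgt0P d) d0 => // [d0 _|-> _]; first by rewrite hwvA //; left.
    by rewrite hwv0; apply/lspanZ/lspan_mem.
  have RB (d : int) t : 0 < d -> hwv M = t -> lspan (eq (hwv M)) (opB d t).
    by move=> d0 <-; rewrite hwvB //; left.
  split; first by left.
  - by move=> a y z; apply: lspanP.
  - by move=> d y; apply: neg_span_stableA.
  by move=> d y; apply: neg_span_stableB.
by apply: (neg_span_word (w := [::])).
Qed.

Local Notation u := (hwv M).
Local Notation eps := (@hwf K M).
Local Notation Kf := (filK u).

Lemma level_eigen n x : levelspan n x -> opA 0 x = (hwt M + n%:R / 2%:R) *: x.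
Proof.
have A0 := @opA_lin _ M 0.
elim=> [|a y z [w [_ [_ <- <- ->]]] _ IH]; first by rewrite (linear_map0 A0) scaler0.
by rewrite A0 IH (weight_word w (hwv0 M)) scalerDr !scalerA mulrC.
Qed.

Lemma ApE d t : @Ap K M d t = opA d%:Z t. Proof. by []. Qed.

Lemma weight_Ap xs lam t : opA 0 t = lam *: t ->
  opA 0 (word_act (@Ap K M) xs t) = (lam - (sumn xs)%:R / 2%:R) *: word_act (@Ap K M) xs t.
Proof.
move=> t0; elim: xs => [|d xs IH] /=; first by rewrite mul0r subr0.
rewrite ApE opA0A IH (linear_mapZ (@opA_lin _ M _)) -scalerBl.
by congr (_ *: _); rewrite natrD; field.
Qed.

Lemma Ap_A0 xs t : exists c, word_act (@Ap K M) xs (opA 0 t) =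
  opA 0 (word_act (@Ap K M) xs t) + c *: word_act (@Ap K M) xs t.
Proof.
elim: xs => [|d xs [c IH]] /=; first by exists 0; rewrite scale0r addr0.
exists (d%:R / 2%:R + c); rewrite IH !ApE opA0A (linear_mapD (@opA_lin _ M _)).
by rewrite (linear_mapZ (@opA_lin _ M _)) scalerDl addrA subrK.
Qed.

Variable Z : pred nat.
Hypothesis wZ : forall d, (0 < d)%N -> (cw M d%:Z == 0) = Z d.
Hypothesis wneg : forall d, (0 < d)%N -> cw M (- d%:Z) != 0.

Let uA := @hwvA K M.
Let uB := @hwvB K M.

(** The mode kills the empty word, and it leaves a B in any word with at least two. A single B(-f)
    gives w(d) v = 0 if f = d, and otherwise a multiple of B(d-f) v, which has no component along
    v. *)
Lemma eps_bad d s : (0 < d)%N -> Z d -> Kf 0 0 s -> eps (opA d%:Z s) = 0.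
Proof.
move=> d0 Zd; have Ad := @opA_lin _ M d.
elim=> [|a x y [w [_ [pw Pw <- ->]]] _ IH].
  by rewrite (linear_map0 Ad) (linear_map0 (@hwf_lin _ M)).
rewrite Ad hwf_lin IH addr0; apply/eqP; rewrite mulf_eq0; apply/orP; right.
have w0 : numA w = 0%N by move: Pw; clear; lia.
have := posA_word uA uB d0 pw w0.
case: w pw w0 {Pw IH} => [|[[] f] [|i w]] //=.
- by move=> *; rewrite uA ?(linear_map0 (@hwf_lin _ M)).
- rewrite andbT => f0 _ _; rewrite /neg_op /= opAB uA // (linear_map0 (@opB_lin _ M _)).
  rewrite scaler0 add0r; case: ifP => [dw|ndw].
    have /eqP -> : cw M d == 0 by rewrite wZ.
    by rewrite scale0r (linear_map0 (@hwf_lin _ M)).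
  rewrite (linear_mapZ (@hwf_lin _ M)); case: (ltP 0 (d%:Z - f%:Z)) => df.
    by rewrite uB // (linear_map0 (@hwf_lin _ M)) scaler0.
  by rewrite hwfB ?scaler0 //; move: ndw df; clear; lia.
move=> _ w0 Kx; rewrite (eps_filK (@hwf_lin _ M) (@hwfB _ M) (u := u)) //.
apply: (neg_span_sub _ Kx) => w' _ /=; move: w0; rewrite /numA /numB /=.
by case: i.1 => //=; lia.
Qed.

(* The zeros of [w] come first, so that [eps_bad] applies to any sorted word in
   which one of them occurs. *)
Definition badfirst : rel nat := fun i j => Z i && ~~ Z j || (Z i == Z j) && (j < i)%N.

Lemma badfirst_trans : transitive badfirst.
Proof.
move=> j i k; rewrite /badfirst; case: (Z i) (Z j) (Z k) => [] [] [] //=;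
 by move=> ji kj; apply: ltn_trans kj ji.
Qed.

Lemma badfirst_tot i j : [|| badfirst i j, i == j | badfirst j i].
Proof. by rewrite /badfirst; case: (Z i) (Z j) => [] [] //=; lia. Qed.

Lemma Ap_comm i j : (0 < i)%N -> (0 < j)%N -> exists c, forall t,
  @Ap K M i (Ap j t) = (-1) ^+ (odd i && odd j) *: Ap j (Ap i t) + c *: Ap (i + j)%N t.
Proof.
move=> i0 j0; exists (cA M i j) => t; rewrite /Ap opAA.
by rewrite ifF ?scale0r ?addr0 //; lia.
Qed.

Lemma Am_comm i j : (0 < i)%N -> (0 < j)%N -> exists c, forall t,
  @Am K M i (Am j t) = (-1) ^+ (odd i && odd j) *: Am j (Am i t) + c *: Am (i + j)%N t.
Proof.
move=> i0 j0; exists (cA M (- i%:Z) (- j%:Z)) => t; rewrite /Am opAA.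
rewrite /sgn !abszN !absz_nat; rewrite ifF ?scale0r ?addr0; last by lia.
by congr (_ + _ *: opA _ _); lia.
Qed.

Definition goodparts n := parts (predC Z) n n.

Lemma good_notZ n m : m \in goodparts n ->
  [/\ all_pos m, sorted (lew gtn) m, all (fun e : nat => cw M e != 0) m & sumn m = n].
Proof.
rewrite mem_parts => /and3P[sm al /eqP sn]; split=> //.
  by apply: sub_all al => i /and3P[].
by apply: sub_all al => i /and3P[i0 _]; rewrite /= wZ.
Qed.

(** Let [R] consist of the vectors of the B-span whose component vanishes after any word in positive
    A's. Nonnegative A's preserve [R] and positive B's kill it, so the negative words on [R] span a
    submodule without component along the highest weight vector, hence zero. To see that [t] is in
    [R], straighten the word of A's: a zero of [w] comes out leftmost and gives nothing, and words
    of sum other than [n] give nothing by weight. *)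
Lemma killed_zero t n : Kf 0 0 t -> opA 0 t = (hwt M + n%:R / 2%:R) *: t ->
  (forall m, m \in goodparts n -> eps (word_act (@Ap K M) m t) = 0) -> t = 0.
Proof.
move=> Kt t0 Ht.
pose R s := Kf 0 0 s /\ forall xs, all_pos xs -> eps (word_act (@Ap K M) xs s) = 0.
have Apl xs := word_act_lin xs (fun i => @opA_lin _ M i%:Z).
have epl := @hwf_lin _ M.
have RA (d : int) s : 0 <= d -> R s -> lspan R (opA d s).
  move=> d0 [Ks Hs]; apply: lspan_mem; case: (ltrgt0P d) d0 => // [d0 _|-> _].
    have -> : d = `|d|%N by lia.
    have d0' : (0 < `|d|)%N by lia.
    split; first exact: filK_A0.
    move=> xs pxs; have := Hs (xs ++ [:: `|d|%N]); rewrite word_act_cat; apply.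
    by rewrite /all_pos all_cat -/(all_pos xs) pxs /= d0'.
  split.
    move: Ks; apply: (lspan_lin (@opA_lin _ M _)) => x [w [_ [pw Pw <- ->]]].
    by rewrite (weight_word w (hwv0 M)); apply/lspanZ/neg_span_word.
  move=> xs pxs; have [c ->] := Ap_A0 xs s.
  by rewrite (linear_mapD epl) (linear_mapZ epl) hwf0 Hs // scaler0 mulr0 addr0.
have RB (d : int) s : 0 < d -> R s -> lspan R (opB d s).
  move=> d0 [Ks Hs]; have -> : d = `|d|%N by lia.
  by rewrite (filK_B0 uB _ Ks); [left|lia].
have Rt : R t.
  split=> // xs pxs.
  have := straighten (fun i => @opA_lin _ M i%:Z) Ap_comm badfirst_trans
    badfirst_tot t pxs.
  elim=> [|a x y [v [-> _ pv sv _]] _ IH]; first exact: (linear_map0 epl).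
  rewrite epl IH addr0; apply/eqP; rewrite mulf_eq0; apply/orP; right; apply/eqP.
  have [allg|] := boolP (all (predC Z) v); last first.
    case: v pv sv => //= i v /andP[i0 pv] sv.
    have [Zi _|nZi] := boolP (Z i).
      apply: eps_bad => //; elim: v pv {sv} => //= j v IHv /andP[j0 pv].
      by apply: filK_A0 => //; apply: IHv.
    move: sv; rewrite /sorted_word path_sortedE; last exact/lew_trans/badfirst_trans.
    case/andP=> al _ /=; case/negP; apply: sub_all al => j.
    rewrite /lew /badfirst /= (negPf nZi) /=; case Zj: (Z j) => //=.
    by case/andP=> /eqP ij; rewrite ij Zj in nZi.
  have sv' : sorted (lew gtn) v.
    apply: (sub_in_sorted _ allg sv) => i j /=; rewrite !inE /= => nZi nZj.
    by rewrite /lew /badfirst (negPf nZi) (negPf nZj).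
  have [svn|nsv] := eqVneq (sumn v) n.
    apply: Ht; rewrite mem_parts sv' svn eqxx andbT /=; apply/allP => i iv.
    by rewrite (allP pv i iv) -{1}svn (leq_sumn iv); apply: (allP allg i iv).
  have := hwf0 (word_act (@Ap K M) v t); rewrite (weight_Ap v t0) (linear_mapZ epl) => /eqP.
  rewrite -subr_eq0 -[X in X - _]/(_ * _) -mulrBl mulf_eq0 => /orP[|/eqP //].
  have -> : hwt M + n%:R / 2%:R - (sumn v)%:R / 2%:R - hwt M =
            (n%:R - (sumn v)%:R) / 2%:R by field.
  rewrite mulf_eq0 invr_eq0 pnatr_eq0 orbF subr_eq0 eqr_nat eq_sym.
  by rewrite (negPf nsv).
apply: (@hw_sep _ M (neg_span (fun=> True) R)).
- split; first by left.
  + by move=> a y z; apply: lspanP.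
  + by move=> d y; apply: neg_span_stableA.
  by move=> d y; apply: neg_span_stableB.
- move=> x; elim=> [|a y z [w [r [pw _ [_ Hr] ->]]] _ IH]; first exact: (linear_map0 epl).
  rewrite epl IH addr0; case: w pw => [_|[[] i] w /andP[/= i0 _]] /=.
  + by rewrite [eps r](Hr [::]) // scaler0.
  + by rewrite /neg_op /= hwfB ?scaler0 //; lia.
  by rewrite /neg_op /= hwfA ?scaler0 //; lia.
by apply: (neg_span_word (w := [::])).
Qed.

Definition basis n : seq (seq nat * seq nat) :=
  [seq p | k <- iota 0 n.+1,
           p <- [seq (l, m) | l <- parts predT k k, m <- goodparts (n - k)]].

Lemma mem_basis n p : (p \in basis n) =
  [&& p.1 \in parts predT (sumn p.1) (sumn p.1), p.2 \in goodparts (sumn p.2)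
    & (sumn p.1 + sumn p.2)%N == n].
Proof.
apply/allpairsPdep/and3P => [[k [_ [kn /allpairsP[[l m] [lk mk ->]] ->]]]|].
  have sl : sumn l = k by move: lk; rewrite mem_parts => /and3P[_ _ /eqP].
  have sm : sumn m = (n - k)%N by move: mk; rewrite mem_parts => /and3P[_ _ /eqP].
  rewrite /= sl sm; split=> //; move: kn; rewrite mem_iota; lia.
case: p => l m [lk mk /eqP sn]; exists (sumn l), (l, m); split=> //.
  by move: sn; rewrite mem_iota /=; lia.
by apply/allpairsP; exists (l, m); split=> //=; rewrite -sn addKn.
Qed.

Lemma basis_uniq n : uniq (basis n).
Proof.
apply: allpairs_uniq_dep; first exact: iota_uniq.
  move=> k _; apply: allpairs_uniq; rewrite ?parts_uniq //.
  by move=> [? ?] [? ?].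
move=> _ _ /allpairsPdep[k [p [_ pk ->]]] /allpairsPdep[k' [p' [_ pk' ->]]] /= epp.
subst p'; suff -> : k = k' by [].
move: pk pk' => /allpairsP[[l m] [lk _ ->]] /allpairsP[[l' m'] [lk' _ [el _]]].
move: lk lk'; rewrite /= -{}el !mem_parts => /and3P[_ _ /eqP <-] /and3P[_ _ /eqP <-].
by [].
Qed.

Lemma size_basis n : size (basis n) =
  (\sum_(i < n.+1) size (parts predT i i) * size (goodparts (n - i)))%N.
Proof.
rewrite size_allpairs_dep sumnE big_map -[n.+1]subn0 -/(index_iota _ _) big_mkord subn0.
by apply: eq_bigr => i _; rewrite size_allpairs.
Qed.

Lemma basisP n p : p \in basis n ->
  [/\ all_pos p.1, all_pos p.2, sorted (lew gtn) p.1, sorted (lew gtn) p.2 &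
   [/\ (sumn p.1 + sumn p.2)%N = n, all (fun e : nat => cw M (- e%:Z) != 0) p.1
    & all (fun e : nat => cw M e%:Z != 0) p.2]].
Proof.
rewrite mem_basis mem_parts => /and3P[/and3P[s1 al _] /good_notZ[p2 s2 w2 _] /eqP sn].
have p1 : all_pos p.1 by apply: sub_all al => i /and3P[].
by split=> //; split=> //; apply: sub_all p1 => i; apply: wneg.
Qed.

(** The pairing of the good words in negative B's with the good words in positive A's is an
    invertible square matrix. Solving for the values taken on the given vector leaves a difference
    that all these functionals annihilate. *)
Lemma B_reduce m : all_pos m ->
  lspan (fun t => exists2 m', m' \in goodparts (sumn m) & t = word_act (@Bm K M) m' u)
      (word_act (@Bm K M) m u).
Proof.
move=> pm; set n := sumn m.
(* Pairs with empty first component make [mono_indep] a statement about the B's alone. *)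
pose r := [seq ([::] : seq nat, s) | s <- goodparts n].
pose F i := nth ([::], [::]) r i.
have ur : uniq r by rewrite map_inj_uniq ?parts_uniq // => ? ? [].
have rP p : p \in r -> p.1 = [::] /\ p.2 \in goodparts n by case/mapP=> s sn ->.
have FP (i : 'I_(size r)) : (F i).1 = [::] /\ (F i).2 \in goodparts n.
  by apply/rP/mem_nth.
have r1 p : p \in r ->
    [/\ all_pos p.1, all_pos p.2, sorted (lew gtn) p.1 & sorted (lew gtn) p.2].
  by case/rP=> -> /good_notZ[].
have r2 p : p \in r -> all (fun e : nat => cw M (- e%:Z) != 0) p.1 /\
    all (fun e : nat => cw M e%:Z != 0) p.2.
  by case/rP=> -> /good_notZ[].
have indep := @mono_indep _ M u uA uB eps (@hwf_lin _ M) (@hwfB _ M) (@hwf_hwv _ M) r.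
have [a Ha] := solve_square (fun c => @indep c ur r1 r2)
  (fun i => eps (word_act (@Ap K M) (F i).2 (word_act (@Bm K M) m u))).
pose t := word_act (@Bm K M) m u - \sum_k a k *: word_act (@Bm K M) (F k).2 u.
have KB s : all_pos s -> Kf 0 0 (word_act (@Bm K M) s u).
  move=> ps; apply: (filK_sub (l := 0%N) (j := size s)) => //.
  exact: (@filK_mono _ _ u [::]).
have eB s : all_pos s -> sumn s = n ->
    opA 0 (word_act (@Bm K M) s u) = (hwt M + n%:R / 2%:R) *: word_act (@Bm K M) s u.
  by move=> ps <-; rewrite -[sumn s]add0n; exact: (@weight_mono _ _ u _ [::] _ (hwv0 M)).
have A0 := @opA_lin _ M 0.
have t0 : t = 0.
  apply: (@killed_zero t n).
  - apply: lspanB; first exact: KB.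
    by apply: lspan_sum => k _; apply/lspanZ/KB; have [_ /good_notZ[]] := FP k.
  - rewrite (linear_mapB A0) eB // scalerBr (linear_map_sum A0) scaler_sumr; congr (_ - _).
    apply: eq_bigr => k _; have [_ /good_notZ[pk _ _ sk]] := FP k.
    by rewrite (linear_mapZ A0) eB // !scalerA mulrC.
  move=> s gs; have sr : ([::], s) \in r by rewrite map_f.
  have lt_s : (index ([::], s) r < size r)%N by rewrite index_mem.
  have Fs : F (index ([::], s) r) = ([::], s) by apply: nth_index.
  have := Ha (Ordinal lt_s); rewrite /= Fs /= => Hs.
  have Al := word_act_lin s (fun i => @opA_lin _ M i%:Z).
  rewrite (linear_mapB Al) (linear_mapB (@hwf_lin _ M)) -Hs (linear_map_sum Al).
  rewrite (linear_map_sum (@hwf_lin _ M)); apply/eqP; rewrite subr_eq0; apply/eqP.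
  apply: eq_bigr => k _; rewrite (linear_mapZ Al) (linear_mapZ (@hwf_lin _ M)).
  by have [Fk _] := FP k; rewrite -/(F k) -/(F (index ([::], s) r)) Fs Fk.
have -> : word_act (@Bm K M) m u = \sum_k a k *: word_act (@Bm K M) (F k).2 u.
  by apply/eqP; rewrite -subr_eq0 -/t t0.
apply: lspan_sum => k _; apply/lspanZ/lspan_mem; exists (F k).2 => //.
by have [] := FP k.
Qed.

(** A negative B and a negative A commute up to a single negative B, which is moved through the
    remaining A's in turn; no scalar can occur. *)
Lemma Bm_Am i l m : (0 < i)%N -> all_pos l -> all_pos m ->
  lspan (fun t => exists l' m', [/\ all_pos l', all_pos m',
         (sumn l' + sumn m' = i + (sumn l + sumn m))%N & t = mono u l' m'])
      (Bm i (mono u l m)).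
Proof.
move=> i0 + pm; elim: l i i0 => [|j l IH] i i0 /=.
  by move=> _; apply: lspan_mem; exists [::], (i :: m); rewrite /= i0.
case/andP=> j0 pl; rewrite /mono /= -/(mono u l m) /Bm /Am opBA.
apply: lspanB; apply: lspanZ.
  apply: (lspan_lin (@opA_lin _ M (- j%:Z)) _ (IH i i0 pl)) => s [l' [m' [pl' pm' sn ->]]].
  apply: lspan_mem; exists (j :: l'), m'; rewrite /= j0; split=> //; lia.
rewrite ifF; last by lia.
have -> : - j%:Z + - i%:Z = - (i + j)%N%:Z by lia.
apply: lspanZ; have ij0 : (0 < i + j)%N by lia.
apply: lspan_sub (IH _ ij0 pl) => s [l' [m' [pl' pm' sn ->]]].
by exists l', m'; split=> //; rewrite sn; lia.
Qed.

Lemma word_mono w : pos_word w ->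
  lspan (fun t => exists l m, [/\ all_pos l, all_pos m,
         (sumn l + sumn m = level w)%N & t = mono u l m]) (word_act (@neg_op K M) w u).
Proof.
elim: w => [|[b i] w IH] /=.
  by move=> _; apply: lspan_mem; exists [::], [::].
case/andP=> /= i0 pw.
apply: (lspan_bind _ (lspan_lin (neg_op_lin (b, i)) 
  (S' := fun t => exists l m, [/\ all_pos l, all_pos m,
         (sumn l + sumn m = level w)%N & t = neg_op (b, i) (mono u l m)]) _ (IH pw))).
  move=> s [l [m [pl pm sn ->]]]; case: b; rewrite /neg_op /=.
    apply: lspan_sub (Bm_Am i0 pl pm) => x [l' [m' [pl' pm' sn' ->]]].
    by exists l', m'; split=> //; rewrite sn' sn.
  apply: lspan_mem; exists (i :: l), m; rewrite /= i0; split=> //.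
  by rewrite -addnA sn.
move=> s [l [m [pl pm sn ->]]]; apply: lspan_mem; exists l, m; split=> //.
Qed.

Lemma mono_basis l m : all_pos l -> all_pos m ->
  lspan (fun t => exists2 p, p \in basis (sumn l + sumn m) & t = mono u p.1 p.2)
      (mono u l m).
Proof.
move=> pl pm.
have gtn_tot i j : [|| gtn i j, i == j | gtn j i] by rewrite /=; lia.
have := straighten (fun i => @opA_lin _ M (- i%:Z)) Am_comm gtn_trans gtn_tot
  (word_act (@Bm K M) m u) pl.
apply: lspan_bind => s [l' [-> sl' pl' sortl' _]].
apply: (lspan_lin (word_act_lin l' (fun i => @opA_lin _ M (- i%:Z))) _ (B_reduce pm)).
move=> x [m' gm' ->]; apply: lspan_mem; exists (l', m') => //.
have [_ _ _ sm'] := good_notZ gm'.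
rewrite mem_basis /= sm' sl'; apply/and3P; split=> //.
rewrite mem_parts; apply/and3P; split=> //; last exact/eqP.
by apply/allP => i il; rewrite (allP pl' i il) -sl' leq_sumn.
Qed.

Lemma level_basis n x : levelspan n x ->
  lspan (fun t => exists2 p, p \in basis n & t = mono u p.1 p.2) x.
Proof.
apply: lspan_bind => s [w [_ [pw <- <- ->]]].
apply: lspan_bind (word_mono pw) => y [l [m [pl pm <- ->]]].
exact: mono_basis.
Qed.

Theorem level_dim n : exists e : 'I_(size (basis n)) -> M,
  [/\ forall i, levelspan n (e i),
      forall c : 'I_(size (basis n)) -> K, \sum_i c i *: e i = 0 -> forall i, c i = 0
    & forall x, levelspan n x ->
        exists c : 'I_(size (basis n)) -> K, x = \sum_i c i *: e i].
Proof.
pose F i := nth ([::], [::]) (basis n) i.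
exists (fun i => mono u (F i).1 (F i).2); split.
- move=> i; have /basisP[p1 p2 _ _ [sn _ _]] : F i \in basis n by apply: mem_nth.
  rewrite mono_word; have [pw _ _ lw] := mono_stats p1 p2.
  by apply: neg_span_word => //; rewrite lw.
- move=> c c0; apply: (mono_indep uA uB (@hwf_lin _ M) (@hwfB _ M) (@hwf_hwv _ M)
    (basis_uniq n)) => [p /basisP[]//|p /basisP[_ _ _ _ []]//|i p].
  have Wl : linear_map (fun t => word_act (@Ap K M) p.2 (word_act (@Bp K M) p.1 t)).
    move=> a x y; rewrite (word_act_lin p.1 (fun i => @opB_lin _ M i%:Z)).
    exact: (word_act_lin p.2 (fun i => @opA_lin _ M i%:Z)).
  have := congr1 (fun t => eps (word_act (@Ap K M) p.2 (word_act (@Bp K M) p.1 t))) c0.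
  rewrite (linear_map0 Wl) (linear_map0 (@hwf_lin _ M)) (linear_map_sum Wl)
    (linear_map_sum (@hwf_lin _ M)).
  move=> H; rewrite -[RHS]H; apply: eq_bigr => k _.
  by rewrite (linear_mapZ Wl) (linear_mapZ (@hwf_lin _ M)).
move=> x /level_basis Lx.
exact: (lspan_range ([::], [::]) (F := fun p => mono u p.1 p.2) Lx).
Qed.

End Upper.

(** * The contragredient dual *)

Section Dual.
Variables (K : numFieldType) (M : hwrep K).
Implicit Types (x : M) (d e : int).

(** The smallest space of functionals that contains [hwf] and is closed under transposes, in
    impredicative form. Generation by [hwf] then holds by construction. *)
Definition dual_span (f : M -> K^o) : Prop := forall S : (M -> K^o) -> Prop,
  S 0 -> (forall a f g, S f -> S g -> S (a *: f + g)) ->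
  (forall d f, S f -> S (fun x => f (opA d x))) ->
  (forall d f, d != 0 -> S f -> S (fun x => f (opB d x))) ->
  S (@hwf K M) -> S f.

Definition dual_pred : {pred (M -> K^o)} := fun f => `[< dual_span f >].

Lemma dual_predP f : reflect (dual_span f) (f \in dual_pred).
Proof. exact: asboolP. Qed.

Lemma dual_pred_submod_closed : submod_closed dual_pred.
Proof.
split; first by apply/dual_predP => S *.
move=> a f g /dual_predP fP /dual_predP gP; apply/dual_predP => S S0 SP SA SB Sh.
by apply: (SP); [apply: fP|apply: gP].
Qed.

HB.instance Definition _ :=
  GRing.isSubmodClosed.Build K (M -> K^o) dual_pred dual_pred_submod_closed.

Record dualT := DualT { dval :> M -> K^o; dvalP : dval \in dual_pred }.
HB.instance Definition _ := [isSub for dval].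
HB.instance Definition _ := [Choice of dualT by <:].
HB.instance Definition _ := [SubChoice_isSubLmodule of dualT by <:].

Lemma dval_lin (f : dualT) : linear_map f.
Proof.
have /dual_predP fP := dvalP f; apply: (fP (fun f => linear_map f)).
- by move=> a x y; rewrite /= scaler0 addr0.
- move=> a g k gl kl b x y; rewrite !fctE gl kl /= scalerDr !scalerA.
  by rewrite mulrC scalerDr scalerA addrACA.
- by move=> d g gl a x y; rewrite opA_lin gl.
- by move=> d g _ gl a x y; rewrite opB_lin gl.
exact: hwf_lin.
Qed.

Lemma dext (f g : dualT) : (forall x, f x = g x) -> f = g.
Proof. by move=> fg; apply/val_inj/funext. Qed.

Lemma dA_proof d (f : dualT) : (fun x => f (opA (- d) x)) \in dual_pred.
Proof.
have /dual_predP fP := dvalP f; apply/dual_predP => S S0 SP SA SB Sh.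
by apply: (SA); apply: fP.
Qed.

Lemma dB_proof d (f : dualT) : (fun x => f (opB (- d) x)) \in dual_pred.
Proof.
have /dual_predP fP := dvalP f; apply/dual_predP => S S0 SP SA SB Sh.
have Sf : S f by apply: fP.
(* Since [opB 0] is a scalar, its transpose multiplies [f] by [hwb M]. *)
have [->|d0] := eqVneq d 0; last by apply: (SB); rewrite ?oppr_eq0.
have -> : (fun x => f (opB (- 0) x)) = hwb M *: (f : M -> K^o) + 0.
  by apply/funext => x; rewrite oppr0 hwB0 (linear_mapZ (dval_lin f)) addr0.
exact: SP.
Qed.

Definition dA d (f : dualT) : dualT := DualT (dA_proof d f).
Definition dB d (f : dualT) : dualT := DualT (dB_proof d f).

Lemma sgnNN d e : sgn K (- d) (- e) = sgn K d e.
Proof. by rewrite /sgn !abszN. Qed.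

Lemma sgnC d e : sgn K d e = sgn K e d.
Proof. by rewrite /sgn andbC. Qed.

Lemma dA_lin d : linear_map (dA d).
Proof. by move=> a f g; apply: dext. Qed.

Lemma dB_lin d : linear_map (dB d).
Proof. by move=> a f g; apply: dext. Qed.

Lemma dAA d e f : dA d (dA e f) = sgn K d e *: dA e (dA d f)
  + cA M (- e) (- d) *: dA (d + e) f
  + (if d + e == 0 then cz M (- e) (- d) else 0) *: f.
Proof.
apply: dext => x; have fl := dval_lin f.
rewrite /= opAA !(linear_mapD fl) !(linear_mapZ fl) sgnNN sgnC addrC -opprD oppr_eq0.
by rewrite [e + d]addrC [RHS]addrC.
Qed.

(** Transposition reverses the product, so [opBA] is what applies. This is the origin of the new
    scalar -(-1)^d w(-d), and hence of the reflection of the zeros. *)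
Lemma dAB d e f : dA d (dB e f) = sgn K d e *: dB e (dA d f)
  + (if d + e == 0 then (- sgn K d d * cw M (- d)) *: f
     else (- sgn K d e * cB M (- d) (- e)) *: dB (d + e) f).
Proof.
apply: dext => x; have fl := dval_lin f.
rewrite /= opBA (linear_mapB fl) !(linear_mapZ fl) sgnNN -opprD oppr_eq0.
case: eqP => [de|_] /=; rewrite (linear_mapZ fl) -mulNr.
  have -> : sgn K d e = sgn K d d.
    have -> : e = - d by apply/eqP; rewrite -addr_eq0 addrC; apply/eqP.
    by rewrite /sgn abszN.
  exact: (congr2 +%R erefl (mulrA _ _ _)).
exact: (congr2 +%R erefl (mulrA _ _ _)).
Qed.

Lemma dBB d e f : dB d (dB e f) = sgn K d e *: dB e (dB d f).
Proof.
apply: dext => x; have fl := dval_lin f.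
by rewrite /= opBB (linear_mapZ fl) sgnNN sgnC.
Qed.

Lemma dA0A d f : dA 0 (dA d f) = dA d (dA 0 f) - (d%:~R / 2%:R) *: dA d f.
Proof.
apply: dext => x; have fl := dval_lin f.
change (f (opA (- d) (opA (- 0) x)) =
  f (opA (- 0) (opA (- d) x)) - (d%:~R / 2%:R) * f (opA (- d) x)).
rewrite oppr0 opA0A (linear_mapB fl) (linear_mapZ fl) mulrNz mulNr scaleNr opprK.
by rewrite addrK.
Qed.

Lemma dA0B d f : dA 0 (dB d f) = dB d (dA 0 f) - (d%:~R / 2%:R) *: dB d f.
Proof.
apply: dext => x; have fl := dval_lin f.
change (f (opB (- d) (opA (- 0) x)) =
  f (opA (- 0) (opB (- d) x)) - (d%:~R / 2%:R) * f (opB (- d) x)).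
rewrite oppr0 opA0B (linear_mapB fl) (linear_mapZ fl) mulrNz mulNr scaleNr opprK.
by rewrite addrK.
Qed.

Definition drep : rep K := Rep dA_lin dB_lin dAA dAB dBB dA0A dA0B.

Lemma hwf_dpred : (hwf (h := M) : M -> K^o) \in dual_pred.
Proof. by apply/dual_predP => S. Qed.

Definition dhwv : drep := DualT hwf_dpred.
Definition dhwf (f : drep) : K := (f : dualT) (hwv M).

Lemma dual_gen (S : drep -> Prop) : stable S -> S dhwv -> forall f, S f.
Proof.
move=> [S0 SP SA SB] Sh f; have /dual_predP fP := dvalP f.
pose S' (g : M -> K^o) := exists2 f : dualT, (f : M -> K^o) = g & S f.
have [g gf Sg] : S' f; last first.
  by have <- : g = f by apply: dext => x; rewrite gf.
apply: fP.
- by exists 0.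
- by move=> a _ _ [g <- Sg] [k <- Sk]; exists (a *: g + k) => //; apply: SP.
- move=> d _ [g <- Sg]; exists (dA (- d) g); last exact: SA.
  by apply/funext => x; rewrite /= opprK.
- move=> d _ d0 [g <- Sg]; exists (dB (- d) g).
    by apply/funext => x; rewrite /= opprK.
  by apply: SB; rewrite ?oppr_eq0.
by exists dhwv.
Qed.

(** The vectors annihilated by every functional in [S] form a stable subspace containing the highest
    weight vector, hence the whole space. *)
Lemma dual_sep (S : drep -> Prop) : stable S -> (forall f, S f -> dhwf f = 0) ->
  forall f, S f -> f = 0.
Proof.
move=> [S0 SP SA SB] Sh f Sf; apply: dext => x.
pose S' x := forall f : drep, S f -> (f : dualT) x = 0.
suff S'x : S' x by apply: S'x.
apply: (hw_gen (S := S')) => //; split.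
- by move=> g _; apply: (linear_map0 (dval_lin g)).
- move=> a y z Sy Sz g Sg; rewrite (dval_lin g) Sy // Sz // scaler0 addr0 //.
- by move=> d y Sy g Sg; rewrite -[d]opprK; apply: (Sy (dA (- d) g)); apply: SA.
move=> d y d0 Sy g Sg; rewrite -[d]opprK; apply: (Sy (dB (- d) g)).
by apply: SB; rewrite ?oppr_eq0.
Qed.

(** The common kernel of the functionals is stable and contained in the kernel of [hwf]. *)
Lemma dual_sep_points x : (forall f : drep, (f : dualT) x = 0) -> x = 0.
Proof.
pose S x := forall f : drep, (f : dualT) x = 0.
apply: (hw_sep (S := S)); last by move=> y /(_ dhwv).
split.
- by move=> g; apply: (linear_map0 (dval_lin g)).
- by move=> a y z Sy Sz g; rewrite (dval_lin g) Sy Sz scaler0 addr0.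
- by move=> d y Sy g; rewrite -[d]opprK; apply: (Sy (dA (- d) g)).
by move=> d y d0 Sy g; rewrite -[d]opprK; apply: (Sy (dB (- d) g)).
Qed.

(** Duality exchanges [hw_gen] and [hw_sep]. The body is kept transparent so that [cw] of the dual
    can be computed. *)
Definition dual : hwrep K.
Proof.
apply: (@HwRep K drep dhwv dhwf (hwt M) (hwb M)).
- by move=> f; apply: dext => x; rewrite /= oppr0 hwB0 (linear_mapZ (dval_lin f)).
- by [].
- by move=> d d0; apply: dext => x; rewrite /= hwfA // oppr_lt0.
- by move=> d d0; apply: dext => x; rewrite /= hwfB // oppr_lt0.
- by apply: dext => x; rewrite /= oppr0 hwf0.
- by move=> d f d0; rewrite /dhwf /= hwvA ?oppr_gt0 // (linear_map0 (dval_lin f)).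
- by move=> d f d0; rewrite /dhwf /= hwvB ?oppr_gt0 // (linear_map0 (dval_lin f)).
- by move=> f; rewrite /dhwf /= oppr0 hwv0 (linear_mapZ (dval_lin f)).
- exact: hwf_hwv.
- exact: dual_gen.
exact: dual_sep.
Defined.

End Dual.

(** * Dimension from an independent and separating family of functionals *)

Section DualBasis.
Variables (K : fieldType) (T : lmodType K) (W : T -> Prop) (c : nat).
Variable phi : 'I_c -> T -> K.
Hypothesis W0 : W 0.
Hypothesis WP : forall a x y, W x -> W y -> W (a *: x + y).
Hypothesis phi_lin : forall i, linear_map (phi i : T -> K^o).
Hypothesis phi_sep : forall x, W x -> (forall i, phi i x = 0) -> x = 0.
Hypothesis phi_ind : forall a : 'I_c -> K,
  (forall x, W x -> \sum_i a i * phi i x = 0) -> forall i, a i = 0.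

(** While k < c, the values on the k vectors found so far satisfy a linear relation among the
    functionals. By independence the relation fails at some [y] in [W], which becomes the next
    vector. *)
Lemma dual_rows k : (k <= c)%N -> exists x : 'I_k -> T, (forall j, W (x j)) /\
  forall a : 'I_k -> K, (forall i, \sum_j a j * phi i (x j) = 0) -> forall j, a j = 0.
Proof.
elim: k => [_|k IH lt_kc].
  by exists (fun=> 0); split=> // a _ [].
have [x [Wx x_ind]] := IH (ltnW lt_kc).
pose A : 'M_(c, k) := \matrix_(i, j) phi i (x j).
have /rowV0Pn[v /sub_kermxP vA v0] : kermx A != 0.
  rewrite kermx_eq0 /row_free neq_ltn; apply/orP; left.
  exact: leq_ltn_trans (rank_leq_col _) lt_kc.
have [y [Wy yv]] : exists y, W y /\ \sum_i v 0 i * phi i y != 0.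
  apply/not_existsP => H; case/negP: v0; apply/eqP/rowP => i; rewrite mxE.
  apply: (phi_ind (a := fun i => v 0 i)) => y Wy.
  by apply/eqP/negPn/negP => yv; apply: (H y).
pose x' (j : 'I_k.+1) := if unlift ord0 j is Some j' then x j' else y.
have x'0 : x' ord0 = y by rewrite /x' unlift_none.
have x'S j : x' (lift ord0 j) = x j by rewrite /x' liftK.
exists x'; split=> [j|a Ha].
  by rewrite /x'; case: unliftP => [j' _|_] //; apply: Wx.
have xa i : a ord0 * phi i y + \sum_j a (lift ord0 j) * phi i (x j) = 0.
  rewrite -[RHS](Ha i) big_ord_recl x'0; congr (_ + _).
  by apply: eq_bigr => j _; rewrite x'S.
have a0 : a ord0 = 0.
  have : \sum_i v 0 i * (a ord0 * phi i y + \sum_j a (lift ord0 j) * phi i (x j)) = 0.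
    by rewrite big1 // => i _; rewrite xa mulr0.
  under eq_bigr => i _ do rewrite mulrDr mulr_sumr.
  rewrite big_split /= exchange_big /= [X in _ + X]big1 ?addr0.
    under eq_bigr => i _ do rewrite mulrCA.
    by rewrite -mulr_sumr => /eqP; rewrite mulf_eq0 (negPf yv) orbF => /eqP.
  move=> j _; under eq_bigr => i _ do rewrite mulrCA.
  rewrite -mulr_sumr; have /rowP/(_ j) := vA; rewrite !mxE => Hj.
  rewrite [X in _ * X](_ : _ = 0) ?mulr0 // -[RHS]Hj.
  by apply: eq_bigr => i _; rewrite mxE.
have aS : forall j, a (lift ord0 j) = 0.
  by apply: x_ind => i; rewrite -[RHS](xa i) a0 mul0r add0r.
by move=> j; case: (unliftP ord0 j) => [j' ->|->].
Qed.

(** Inverting the matrix of values gives vectors dual to the functionals; since these separate [W],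
    each vector equals its expansion with their values as coefficients. *)
Lemma dual_basis : exists e : 'I_c -> T, [/\ forall i, W (e i),
  forall a : 'I_c -> K, \sum_i a i *: e i = 0 -> forall i, a i = 0
  & forall x, W x -> exists a : 'I_c -> K, x = \sum_i a i *: e i].
Proof.
have [x [Wx x_ind]] := dual_rows (leqnn c).
have Wsum (a : 'I_c -> K) (f : 'I_c -> T) : (forall j, W (f j)) -> W (\sum_j a j *: f j).
  move=> Wf; apply: (big_ind W) => // [s t Ws Wt|j _].
    by rewrite -[s]scale1r; apply: WP.
  by rewrite -[_ *: _]addr0; apply: WP.
have phi_sum i (a : 'I_c -> K) (f : 'I_c -> T) :
    phi i (\sum_j a j *: f j) = \sum_j a j * phi i (f j).
  rewrite (linear_map_sum (@phi_lin i)); apply: eq_bigr => j _.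
  by rewrite (linear_mapZ (@phi_lin i)).
have [g Hg] := choice (fun l : 'I_c => solve_square x_ind (fun i => (i == l)%:R)).
pose e l := \sum_j g l j *: x j.
have We l : W (e l) by apply: Wsum.
have phie i l : phi i (e l) = (i == l)%:R by rewrite phi_sum Hg.
have phi_coef i (a : 'I_c -> K) : phi i (\sum_j a j *: e j) = a i.
  rewrite phi_sum (bigD1 i) //= phie eqxx mulr1 big1 ?addr0 // => j ne.
  by rewrite phie eq_sym (negPf ne) mulr0.
exists e; split=> // [a a0 i|y Wy].
  by rewrite -(phi_coef i) a0 (linear_map0 (@phi_lin i)).
exists (fun i => phi i y); apply/eqP; rewrite -subr_eq0; apply/eqP/phi_sep.
  rewrite addrC -scaleN1r; apply: WP => //; exact: Wsum.
by move=> i; rewrite (linear_mapB (@phi_lin i)) phi_coef; apply: subrr.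
Qed.
End DualBasis.

(** * Dimensions when the zeros of [w] lie at negative modes *)

Section DualDim.
Variables (K : numFieldType) (M : hwrep K) (Z : pred nat).
Hypothesis wZ : forall d, (0 < d)%N -> (cw M (- d%:Z) == 0) = Z d.
Hypothesis wpos : forall d, (0 < d)%N -> cw M d%:Z != 0.

(** [opA 0] is its own transpose, so levels of different weight are orthogonal. *)
Lemma level_mismatch m n x (f : dual M) : levelspan m x -> levelspan n f -> m != n ->
  (f : dualT M) x = 0.
Proof.
move=> /level_eigen xm /level_eigen fn mn.
have := congr1 (fun g : dualT M => g x) fn; rewrite /= oppr0 xm => /eqP.
rewrite (linear_mapZ (dval_lin _)) -subr_eq0 -[X in X == 0]/(_ * _ - _ * _) -mulrBl mulf_eq0.
case/orP=> [|/eqP //]; rewrite opprD addrACA subrr add0r -mulrBl mulf_eq0 invr_eq0.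
by rewrite pnatr_eq0 orbF subr_eq0 eqr_nat (negPf mn).
Qed.

(** A basis of this level of the dual is an independent and separating family on the same level of
    [M]: orthogonality of the levels reduces both properties from the whole spaces to the level. *)
Theorem level_dim_dual n : exists e : 'I_(size (basis Z n)) -> M,
  [/\ forall i, levelspan n (e i),
      forall c : 'I_(size (basis Z n)) -> K, \sum_i c i *: e i = 0 -> forall i, c i = 0
    & forall x, levelspan n x ->
        exists c : 'I_(size (basis Z n)) -> K, x = \sum_i c i *: e i].
Proof.
have [|d d0|phi [Lphi phi_ind phi_span]] := @level_dim K (dual M) Z _ _ n.
- by move=> d d0; rewrite /= mulf_eq0 oppr_eq0 signr_eq0 wZ.
- by rewrite /= mulf_neq0 ?oppr_eq0 ?signr_eq0 // opprK wpos.
have phi_sum (c : 'I_(size (basis Z n)) -> K) x :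
    ((\sum_i c i *: phi i : dual M) : dualT M) x = \sum_i c i * (phi i : dualT M) x.
  apply: (big_ind2 (fun (f : dual M) y => (f : dualT M) x = y)) => //.
  by move=> f y g z <- <-.
apply: (@dual_basis K M (levelspan n) _ (fun i x => (phi i : dualT M) x)).
- by left.
- by move=> a x y; apply: lspanP.
- by move=> i; apply: dval_lin.
- move=> x Lx x0; apply: dual_sep_points => f.
  have := @word_gen K (dual M) f; elim=> [//|a g g' [w [_ [pw _ <- ->]]] _ IH].
  rewrite -[LHS]/(a * (_ : dualT M) x + (g' : dualT M) x) IH addr0.
  have Lw : levelspan (level w) (word_act (@neg_op K (dual M)) w (hwv (dual M))).
    by apply: neg_span_word.
  have [lw|nw] := eqVneq (level w) n; last first.
    by rewrite (level_mismatch Lx Lw) ?mulr0 // eq_sym.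
  rewrite lw in Lw; have [c ->] := phi_span _ Lw.
  by rewrite phi_sum big1 ?mulr0 // => i _; rewrite x0 mulr0.
move=> a Ha; apply: phi_ind; apply: dext => x.
have Lf : levelspan n (\sum_i a i *: phi i).
  by apply: lspan_sum => i _; apply: (lspanZ _ (Lphi i)).
have := word_gen x; have fl := dval_lin (\sum_i a i *: phi i : dualT M).
elim=> [|b y z [w [_ [pw _ <- ->]]] _ IH]; first exact: (linear_map0 fl).
rewrite fl IH addr0.
have Lw : levelspan (level w) (word_act (@neg_op K M) w (hwv M)) by apply: neg_span_word.
have [lw|nw] := eqVneq (level w) n.
  by rewrite phi_sum Ha ?scaler0 // -lw.
by rewrite (level_mismatch Lw Lf nw) scaler0.
Qed.
End DualDim.

(** * Weights *)

Section Levels.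
Variables (K : numFieldType) (M : rep K) (u : M) (h : K).
Hypothesis u0 : opA 0 u = h *: u.

Let lam (m : nat) : K := h + m%:R / 2%:R.

Lemma lam_inj : injective lam.
Proof.
move=> m n /addrI/(mulIf _) H; apply/eqP; rewrite -(eqr_nat K); apply/eqP/H.
by rewrite invr_eq0 pnatr_eq0.
Qed.

Lemma neg_span_eigen n (P : seq (bool * nat) -> Prop) x :
  neg_span (fun w => P w /\ level w = n) (eq u) x -> opA 0 x = lam n *: x.
Proof.
have A0 := @opA_lin _ M 0.
elim=> [|a y z [w [_ [_ [_ <-] <- ->]]] _ IH]; first by rewrite (linear_map0 A0) scaler0.
by rewrite A0 IH (weight_word w u0) scalerDr !scalerA mulrC.
Qed.

Lemma level_decomp (P : seq (bool * nat) -> Prop) x : neg_span P (eq u) x ->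
  exists (s : nat -> M) (N0 : nat),
    (forall m, neg_span (fun w => P w /\ level w = m) (eq u) (s m)) /\
    forall N, (N0 <= N)%N -> x = \sum_(m < N) s m.
Proof.
elim=> [|a y z [w [_ [pw Pw <- ->]]] _ [s [N0 [Ls sN]]]].
  exists (fun=> 0), 0%N; split=> [m|N _]; first by left.
  by rewrite big1.
exists (fun m => (if m == level w then a *: word_act (@neg_op K M) w u else 0) + s m).
exists (maxn N0 (level w).+1); split=> [m|N].
  apply: lspanD; last exact: Ls.
  have [->|_] := eqVneq m (level w); last by left.
  by apply/lspanZ/neg_span_word.
rewrite geq_max => /andP[N0N wN]; rewrite big_split /= -sN //; congr (_ + _).
rewrite (bigD1 (Ordinal wN)) //= eqxx big1 ?addr0 // => i.
by rewrite -val_eqE /= => /negPf ->.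
Qed.

Hypothesis gen : forall x, neg_span (fun=> True) (eq u) x.

(** Distinct levels have distinct weights, so all components of an eigenvector but one vanish. *)
Lemma eigen_level x mu : opA 0 x = mu *: x -> x != 0 ->
  exists2 n, mu = lam n & neg_span (fun w => level w = n) (eq u) x.
Proof.
move=> xmu x0; have [s [N [Ls sN]]] := level_decomp (gen x).
have {sN} sN := sN N (leqnn N).
have A0 := @opA_lin _ M 0.
have es m := neg_span_eigen (Ls m).
have z m : (m < N)%N -> (lam m - mu) *: s m = 0.
  move=> mN; apply: (eigen_indep (s := fun m => (lam m - mu) *: s m) lam_inj _ _ mN).
    by move=> k; rewrite (linear_mapZ A0) es !scalerA mulrC.
  have : opA 0 x - mu *: x = 0 by rewrite xmu subrr.
  rewrite {1 2}sN (linear_map_sum A0) scaler_sumr -sumrB => H; rewrite -[RHS]H.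
  by apply: eq_bigr => k _; rewrite es scalerBl.
have [k sk] : exists k : 'I_N, s k != 0.
  apply/not_existsP => H; case/eqP: x0; rewrite sN big1 // => k _.
  by apply/eqP/negPn/negP => /H.
have /eqP := z k (ltn_ord k); rewrite scaler_eq0 (negPf sk) orbF subr_eq0 => /eqP lk.
exists k; first by [].
rewrite sN (bigD1 k) //= big1 ?addr0; first by apply: neg_span_sub (Ls k) => w _ [].
move=> j jk; have /eqP := z j (ltn_ord j).
rewrite scaler_eq0 -lk subr_eq0 => /orP[/eqP/lam_inj/val_inj ej|/eqP //].
by rewrite ej eqxx in jk.
Qed.

Hypothesis u_neq0 : u != 0.

Let N := neg_span (fun w => w != [::] : Prop) (eq u).

Lemma hw_notin_neg : ~ N u.
Proof.
move=> /level_decomp[s [N0 [Ls sN]]]; case/eqP: u_neq0.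
have s0 : s 0%N = 0.
  have := Ls 0%N; apply: (lspan_false (S := _)) => y [w [_ [pw [w0 lw0] _ _]]].
  by case: w pw w0 lw0 => // i w /andP[]; rewrite /level /=; lia.
(* With -u as component of level 0, the assumed expression of [u] becomes a vanishing sum of
   eigenvectors of distinct weights. *)
pose s' m := if m == 0%N then - u else s m.
suff /eqP : s' 0%N = 0 by rewrite /s' eqxx oppr_eq0 => /eqP.
apply: (eigen_indep (N := N0.+1) (s := s') lam_inj) => // [m|].
  rewrite /s'; case: eqP => [->|_]; last exact: (neg_span_eigen (Ls m)).
  by rewrite (linear_mapN (@opA_lin _ M 0)) u0 /lam mul0r addr0 scalerN.
rewrite big_ord_recl {1}/s' eqxx.
rewrite {1}(sN N0.+1) // big_ord_recl s0 add0r addrC; apply/eqP; rewrite subr_eq0.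
by apply/eqP/eq_bigr.
Qed.

Lemma hw_coef x : exists c, N (x - c *: u).
Proof.
elim: (gen x) => [|a y z [w [_ [pw _ <- ->]]] _ [c Nc]].
  by exists 0; rewrite scale0r subr0; left.
case: w pw => [_|i w pw].
  by exists (a + c); rewrite scalerDl /= opprD addrACA subrr add0r.
exists c; rewrite -addrA; apply: lspanP => //; exact: neg_span_word.
Qed.

(** The component along [u], modulo the span of the nonempty words. *)
Definition hw_fun x : K := projT1 (cid (hw_coef x)).

Lemma hw_funP x : N (x - hw_fun x *: u).
Proof. by rewrite /hw_fun; case: cid. Qed.

Lemma hw_fun_uniq x c : N (x - c *: u) -> hw_fun x = c.
Proof.
move=> Nc; apply/eqP/negPn/negP => ne; apply: hw_notin_neg.
have ne' : hw_fun x - c != 0 by rewrite subr_eq0.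
have := lspanZ (hw_fun x - c)^-1 (lspanB Nc (hw_funP x)).
by rewrite opprB [X in _ *: X]addrC subrKA -scalerBl scalerA mulVf // scale1r.
Qed.

Lemma hw_fun_lin : linear_map (hw_fun : M -> K^o).
Proof.
move=> a x y; apply: hw_fun_uniq.
have := lspanP a (hw_funP x) (hw_funP y).
by rewrite scalerBr scalerA addrACA -opprD -scalerDl.
Qed.

Lemma hw_fun_neg (i : bool * nat) x : (0 < i.2)%N -> hw_fun (neg_op i x) = 0.
Proof.
move=> i0; apply: hw_fun_uniq; rewrite scale0r subr0.
exact: (neg_span_cons i0 _ (gen x)).
Qed.

Lemma hw_funA (d : int) x : d < 0 -> hw_fun (opA d x) = 0.
Proof. by move=> d0; rewrite (opA_neg _ (ltW d0)) hw_fun_neg //=; lia. Qed.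

Lemma hw_funB (d : int) x : d < 0 -> hw_fun (opB d x) = 0.
Proof. by move=> d0; rewrite (opB_neg _ (ltW d0)) hw_fun_neg //=; lia. Qed.

Lemma hw_fun0 x : hw_fun (opA 0 x) = h * hw_fun x.
Proof.
apply: hw_fun_uniq.
have -> : opA 0 x - (h * hw_fun x) *: u = opA 0 (x - hw_fun x *: u).
  rewrite (linear_mapB (@opA_lin _ M 0)) (linear_mapZ (@opA_lin _ M 0)) u0 scalerA.
  by rewrite mulrC.
apply: (lspan_lin (@opA_lin _ M 0) _ (hw_funP x)) => s [w [_ [pw Pw <- ->]]].
by rewrite (weight_word w u0); apply/lspanZ/neg_span_word.
Qed.

Lemma hw_fun_u : hw_fun u = 1.
Proof. by apply: hw_fun_uniq; rewrite scale1r subrr; left. Qed.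

End Levels.

(** * Modules over the N=1 Heisenberg-Virasoro algebra *)

Definition half (d : int) : int := (d %/ 2)%Z.
Definition oddz (d : int) : bool := odd `|d|%N.

Lemma half_odd d : d = 2 * half d + (oddz d)%:Z.
Proof. rewrite /half /oddz; lia. Qed.

Lemma parity_ind (P : int -> Prop) :
  (forall m, P (2 * m)) -> (forall m, P (2 * m + 1)) -> forall d, P d.
Proof.
move=> Pe Po d; rewrite (half_odd d); case: (oddz d); first exact: Po.
by rewrite addr0; apply: Pe.
Qed.

Lemma half2 m : half (2 * m) = m.
Proof. rewrite /half; lia. Qed.
Lemma half21 m : half (2 * m + 1) = m.
Proof. rewrite /half; lia. Qed.
Lemma oddz2 m : oddz (2 * m) = false.
Proof. rewrite /oddz; lia. Qed.
Lemma oddz21 m : oddz (2 * m + 1) = true.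
Proof. rewrite /oddz; lia. Qed.

Section FromModule.
Variables (R : realType) (M : shModule R).
Local Notation C := R[i].

Definition act (k : shIdx) (t : M) : M := sh_act (sh_basis R k) t.

Lemma act_lin k : linear_map (act k).
Proof. by move=> a x y; apply: sh_act_linr. Qed.

Lemma sh_act_islin t : linear_map (fun z : SH R => sh_act z t : M).
Proof. by move=> a x y; apply: sh_act_linl. Qed.

Lemma msupp_basis k : msupp (sh_basis R k) = [fset k]%fset.
Proof. by rewrite /sh_basis msuppU oner_eq0. Qed.

Lemma sh_act_expand (x : SH R) t : sh_act x t = \sum_(k <- msupp x) x@_k *: act k t.
Proof.
rewrite {1}[x]monalgE (linear_map_sum (sh_act_islin t)); apply: eq_bigr => k _.
have -> : << x@_k *g k >> = x@_k *: sh_basis R k.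
  by apply/malgP => j; rewrite mcoeffZ !mcoeffU mulrnAr mulr1.
by rewrite (linear_mapZ (sh_act_islin t)).
Qed.

Lemma act_comm k l t : act k (act l t) =
  (-1) ^+ (sh_odd k && sh_odd l) *: act l (act k t) + sh_act (sh_bracket_idx R k l) t.
Proof.
have hom j : sh_homog (sh_odd j) (sh_basis R j).
  by move=> i; rewrite msupp_basis inE => /eqP ->.
have := sh_act_bracket t (hom k) (hom l); rewrite sh_bracket_basis => ->.
by rewrite addrC subrK.
Qed.

Definition fA (d : int) : M -> M := act (if oddz d then iG (half d) else iL (half d)).
Definition fB (d : int) : M -> M := act (if oddz d then iPsi (half d) else iA (half d)).

Variables (cL cLA h ha : C) (u : M).
Hypothesis actCL : forall w : M, act iCL w = cL *: w.
Hypothesis actCA : forall w : M, act iCA w = 0.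
Hypothesis actCLA : forall w : M, act iCLA w = cLA *: w.
Hypothesis actA0 : forall w : M, act (iA 0) w = ha *: w.

Definition fcA (d e : int) : C :=
  let m : C := (half d)%:~R in let n : C := (half e)%:~R in
  match oddz d, oddz e with
  | false, false => m - n
  | false, true => m / 2%:R - n - 2%:R^-1
  | true, false => - (n / 2%:R - m - 2%:R^-1)
  | true, true => 2%:R
  end.

Definition fcz (d e : int) : C :=
  let m : C := (half d)%:~R in
  match oddz d, oddz e with
  | false, false => (m ^+ 3 - m) / 12%:R * cL
  | true, true => (m ^+ 2 + m) / 3%:R * cL
  | _, _ => 0
  end.

Definition fcB (d e : int) : C :=
  let m : C := (half d)%:~R in let n : C := (half e)%:~R in
  match oddz d, oddz e with
  | false, false => - n
  | false, true => - ((2%:R * n + m + 1) / 2%:R)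
  | true, false => - n
  | true, true => 1
  end.

(** The bracket of L(m) with alpha(-m), and that of G(m+1/2) with Psi(-m-1/2), once alpha(0) acts as
    [ha]. The latter is [brPsiG] with first index -m-1, whence the term -2(m+1). *)
Definition fcw (d : int) : C :=
  let m : C := (half d)%:~R in
  if oddz d then ha - 2%:R * (m + 1) * cLA else m * ha - (m ^+ 2 + m) * cLA.

Lemma act_opp x t : sh_act (- x) t = - sh_act x t :> M.
Proof. exact: (linear_mapN (sh_act_islin t)). Qed.

Lemma fA2 m : fA (2 * m) = act (iL m).
Proof. by rewrite /fA oddz2 half2. Qed.
Lemma fA21 m : fA (2 * m + 1) = act (iG m).
Proof. by rewrite /fA oddz21 half21. Qed.
Lemma fB2 m : fB (2 * m) = act (iA m).
Proof. by rewrite /fB oddz2 half2. Qed.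
Lemma fB21 m : fB (2 * m + 1) = act (iPsi m).
Proof. by rewrite /fB oddz21 half21. Qed.

Lemma act_lincomb a b (x y : SH R) t :
  sh_act (a *: x + b *: y) t = a *: sh_act x t + b *: sh_act y t :> M.
Proof. by rewrite sh_act_linl (linear_mapZ (sh_act_islin t)). Qed.

Lemma fA_lin d : linear_map (fA d). Proof. exact: act_lin. Qed.
Lemma fB_lin d : linear_map (fB d). Proof. exact: act_lin. Qed.

Lemma fAA d e t : fA d (fA e t) =
  sgn C d e *: fA e (fA d t) + fcA d e *: fA (d + e) t
  + (if d + e == 0 then fcz d e else 0) *: t.
Proof.
rewrite /sgn -!/(oddz _) -addrA.
elim/parity_ind: d => m; elim/parity_ind: e => n.
- have -> : 2 * m + 2 * n = 2 * (m + n) by ring.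
  rewrite !fA2 act_comm /fcA /fcz !oddz2 !half2; congr (_ + _).
  rewrite /= /brLL act_lincomb; congr (_ *: _ + _); first by rewrite rmorphB.
  rewrite -/(act iCL t) actCL scalerA; congr (_ *: _).
  have -> : (2 * (m + n) == 0) = (m + n == 0) by lia.
  by case: ifP; rewrite ?mul1r ?mul0r.
- have -> : 2 * m + (2 * n + 1) = 2 * (m + n) + 1 by ring.
  rewrite !fA2 !fA21 act_comm /fcA /fcz !oddz2 !oddz21 !half2 !half21; congr (_ + _).
  by rewrite /= /brLG (linear_mapZ (sh_act_islin t)) if_same scale0r addr0.
- have -> : 2 * m + 1 + 2 * n = 2 * (n + m) + 1 by ring.
  rewrite !fA2 !fA21 act_comm /fcA /fcz !oddz2 !oddz21 !half2 !half21; congr (_ + _).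
  rewrite /= /brLG -scaleNr (linear_mapZ (sh_act_islin t)) if_same scale0r addr0.
  by [].
have -> : 2 * m + 1 + (2 * n + 1) = 2 * (m + n + 1) by ring.
rewrite !fA2 !fA21 act_comm /fcA /fcz !oddz21 !half21; congr (_ + _).
rewrite /= /brGG act_lincomb; congr (_ + _).
rewrite -/(act iCL t) actCL scalerA; congr (_ *: _).
have -> : (2 * (m + n + 1) == 0) = (m + n + 1 == 0) by lia.
by case: ifP; rewrite ?mul1r ?mul0r.
Qed.

Lemma fAB d e t : fA d (fB e t) = sgn C d e *: fB e (fA d t)
  + (if d + e == 0 then fcw d *: t else fcB d e *: fB (d + e) t).
Proof.
rewrite /sgn -!/(oddz _).
elim/parity_ind: d => m; elim/parity_ind: e => n.
- have -> : 2 * m + 2 * n = 2 * (m + n) by ring.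
  rewrite !fA2 !fB2 act_comm /fcB /fcw !oddz2 !half2; congr (_ + _).
  rewrite /= /brLA -scaleNr act_lincomb.
  have -> : (2 * (m + n) == 0) = (m + n == 0) by lia.
  rewrite -/(act _ t) -/(act iCLA t) actCLA; case: eqP => [mn|_].
    have -> : n = - m by lia.
    rewrite addrN actA0 mul1r rmorphN opprK !scalerA -scalerDl.
    by congr (_ *: _); rewrite mulNr.
  by rewrite mul0r oppr0 scale0r addr0.
- have -> : 2 * m + (2 * n + 1) = 2 * (n + m) + 1 by ring.
  rewrite !fA2 !fB21 act_comm /fcB /fcw !oddz2 !oddz21 !half2 !half21; congr (_ + _).
  rewrite /= /brPsiL -scaleNr (linear_mapZ (sh_act_islin t)) ifF; last by lia.
  by congr (- (_ / _) *: _); rewrite !rmorphD rmorphM.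
- have -> : 2 * m + 1 + 2 * n = 2 * (n + m) + 1 by ring.
  rewrite !fA21 !fB2 !fB21 act_comm /fcB /fcw !oddz2 !oddz21 !half2 !half21; congr (_ + _).
  by rewrite /= /brAG -scaleNr (linear_mapZ (sh_act_islin t)) ifF; last by lia.
have -> : 2 * m + 1 + (2 * n + 1) = 2 * (n + m + 1) by ring.
rewrite !fA21 !fB2 !fB21 act_comm /fcB /fcw !oddz21 !half21; congr (_ + _).
rewrite /= /brPsiG -[sh_basis R (iA _)]scale1r act_lincomb.
have -> : (2 * (n + m + 1) == 0) = (n + m + 1 == 0) by lia.
rewrite -/(act _ t) -/(act iCLA t) actCLA; case: eqP => [mn|_].
  have en : n = - (m + 1) by lia.
  rewrite mn actA0 mul1r scale1r scalerA -scalerDl en rmorphN rmorphD.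
  by rewrite mulrN mulNr.
by rewrite mul0r scale0r addr0.
Qed.

Lemma fBB d e t : fB d (fB e t) = sgn C d e *: fB e (fB d t).
Proof.
rewrite /sgn -!/(oddz _) -[RHS]addr0.
elim/parity_ind: d => m; elim/parity_ind: e => n;
  rewrite ?fB2 ?fB21 act_comm ?oddz2 ?oddz21; congr (_ + _); rewrite /=.
- by rewrite /brAA (linear_mapZ (sh_act_islin t)) -/(act iCA t) actCA scaler0.
- exact: (linear_map0 (sh_act_islin t)).
- exact: (linear_map0 (sh_act_islin t)).
by rewrite /brPsiPsi (linear_mapZ (sh_act_islin t)) -/(act iCA t) actCA scaler0.
Qed.

Lemma fcA0 d : fcA 0 d = - (d%:~R / 2%:R).
Proof.
rewrite /fcA; elim/parity_ind: d => m.
  by rewrite -[0](mulr0 2) !oddz2 !half2 intrM sub0r mulrAC mulfV ?mul1r // pnatr_eq0.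
rewrite -[0](mulr0 2) !oddz2 !half2 oddz21 half21 intrD intrM mul0r sub0r.
by rewrite mulrDl mulrAC mulfV ?pnatr_eq0 // !mul1r opprD.
Qed.

Lemma fcB0 d : fcB 0 d = - (d%:~R / 2%:R).
Proof.
rewrite /fcB; elim/parity_ind: d => m.
  by rewrite -[0](mulr0 2) !oddz2 !half2 intrM mulrAC mulfV ?mul1r // pnatr_eq0.
rewrite -[0](mulr0 2) !oddz2 !half2 oddz21 half21 intrD intrM.
by rewrite addr0.
Qed.

Lemma sgn0 d : sgn C 0 d = 1. Proof. by []. Qed.

Lemma half0 : half 0 = 0. Proof. exact: (half2 0). Qed.
Lemma oddz0 : oddz 0 = false. Proof. by []. Qed.

Lemma fA0A d t : fA 0 (fA d t) = fA d (fA 0 t) - (d%:~R / 2%:R) *: fA d t.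
Proof.
rewrite fAA sgn0 scale1r fcA0 add0r scaleNr.
have [->|_] := eqVneq d 0; last by rewrite scale0r addr0.
by rewrite /fcz oddz0 half0 mulr0z expr0n subrr !mul0r !scale0r addr0.
Qed.

Lemma fA0B d t : fA 0 (fB d t) = fB d (fA 0 t) - (d%:~R / 2%:R) *: fB d t.
Proof.
rewrite fAB sgn0 scale1r fcB0 add0r scaleNr; have [->|//] := eqVneq d 0.
by rewrite /fcw oddz0 half0 mulr0z expr0n addr0 !mul0r subrr !scale0r oppr0.
Qed.

Definition mrep : rep C := Rep fA_lin fB_lin fAA fAB fBB fA0A fA0B.

End FromModule.

(** * Simple highest weight modules as instances of [hwrep] *)

Section SimpleModule.
Variables (R : realType) (M : shModule R).
Local Notation C := R[i].
Variables (cL cLA h ha : C) (u : M).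
Hypothesis u_hwv : sh_hwv cL cLA h ha u.
Hypothesis u_neq0 : u != 0.
Hypothesis M_simple : sh_simple M.

Lemma idx_submodule (S : M -> Prop) : S 0 ->
  (forall a v w, S v -> S w -> S (a *: v + w)) ->
  (forall k v, S v -> S (act k v)) -> sh_submodule S.
Proof.
move=> S0 SP Sa; split=> // x v Sv; rewrite sh_act_expand.
apply: (big_ind S) => // [y z Sy Sz|k _]; first by rewrite -[y]scale1r; apply: SP.
by rewrite -[_ *: _]addr0; apply: SP => //; apply: Sa.
Qed.

Lemma simple_gen (S : M -> Prop) : S 0 ->
  (forall a v w, S v -> S w -> S (a *: v + w)) ->
  (forall k v, S v -> S (act k v)) ->
  forall x, S x -> x != 0 -> forall w, S w.
Proof.
move=> S0 SP Sa x Sx x0; have [_ H] := M_simple.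
by apply: H; [apply: idx_submodule|exists x].
Qed.

Lemma hw_actCL (w : M) : act iCL w = cL *: w.
Proof. by have [[H _ _] _ _ _] := u_hwv; apply: H. Qed.
Lemma hw_actCA (w : M) : act iCA w = 0.
Proof. by have [[_ H _] _ _ _] := u_hwv; apply: H. Qed.
Lemma hw_actCLA (w : M) : act iCLA w = cLA *: w.
Proof. by have [[_ _ H] _ _ _] := u_hwv; apply: H. Qed.

Lemma hw_pos k : sh_pos k -> act k u = 0.
Proof.
have [_ H _ _] := u_hwv; move=> pk; apply: H => j.
by rewrite msupp_basis inE => /eqP ->.
Qed.

(** The cocycle (m^2+m) C_(L,alpha) in the bracket of L(m) with alpha(0) is supported at m = 0,
    where it vanishes; the other terms are zero or carry the index 0 as a factor. *)
Lemma alpha0_central k (w : M) : act (iA 0) (act k w) = act k (act (iA 0) w).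
Proof.
have sl := @sh_act_islin R M w.
rewrite act_comm expr0 scale1r -[RHS]addr0; congr (_ + _).
case: k => [n|n|n|n|||] /=; rewrite ?(linear_map0 sl) //.
- rewrite act_opp /brLA addr0 oppr0 scale0r sub0r act_opp (linear_mapZ sl).
  rewrite -/(act iCLA w) hw_actCLA; case: eqP => [->|_].
    by rewrite expr0n addr0 mulr0 scale0r !oppr0.
  by rewrite mul0r scale0r !oppr0.
- by rewrite /brAA mulr0 scale0r (linear_map0 sl).
by rewrite /brAG scale0r (linear_map0 sl).
Qed.

(** The eigenspace of the central operator alpha(0) is a submodule containing [u], hence everything
    by simplicity. *)
Lemma hw_actA0 (w : M) : act (iA 0) w = ha *: w.
Proof.
apply: (simple_gen (S := fun w => act (iA 0) w = ha *: w)) u_neq0 w.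
- by rewrite (linear_map0 (@act_lin R M _)) scaler0.
- by move=> a v w Hv Hw; rewrite act_lin Hv Hw scalerDr !scalerA mulrC.
- by move=> k v Hv; rewrite alpha0_central Hv (linear_mapZ (@act_lin R M _)).
by have [] := u_hwv.
Qed.

Definition srep : rep C := mrep hw_actCL hw_actCA hw_actCLA hw_actA0.

(** This carries stability under the modes A(d) and the B(d) with d nonzero over to all generators:
    alpha(0) and the central elements act as scalars. *)
Lemma srep_act (S : M -> Prop) : S 0 -> (forall a v w, S v -> S w -> S (a *: v + w)) ->
  (forall d v, S v -> S (fA d v)) ->
  (forall d : int, d != 0 -> forall v, S v -> S (fB d v)) ->
  forall k v, S v -> S (act k v).
Proof.
move=> S0 SP SA SB k v Sv.
have SZ a w : S w -> S (a *: w) by move=> Sw; rewrite -[_ *: _]addr0; apply: SP.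
case: k => [n|n|n|n|||].
- by rewrite -fA2; apply: SA.
- have [->|n0] := eqVneq n 0; first by rewrite hw_actA0; apply: SZ.
  by rewrite -fB2; apply: SB => //; lia.
- by rewrite -fA21; apply: SA.
- by rewrite -fB21; apply: SB => //; lia.
- by rewrite hw_actCL; apply: SZ.
- by rewrite hw_actCA.
by rewrite hw_actCLA; apply: SZ.
Qed.

Lemma srep_A (d : int) : 0 < d -> @opA _ srep d u = 0.
Proof.
rewrite /=; elim/parity_ind: d => m m0.
  by rewrite fA2 hw_pos //=; lia.
by rewrite fA21 hw_pos //=; lia.
Qed.

Lemma srep_B (d : int) : 0 < d -> @opB _ srep d u = 0.
Proof.
rewrite /=; elim/parity_ind: d => m m0.
  by rewrite fB2 hw_pos //=; lia.
by rewrite fB21 hw_pos //=; lia.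
Qed.

Lemma srep_A0 (w : M) : @opA _ srep 0 w = act (iL 0) w.
Proof. by rewrite /= -(fA2 M 0). Qed.

Lemma srep_hw : @opA _ srep 0 u = h *: u.
Proof. by rewrite srep_A0; have [] := u_hwv. Qed.

Lemma srep_B0 (w : M) : @opB _ srep 0 w = ha *: w.
Proof. by rewrite -hw_actA0 /= -(fB2 M 0). Qed.

Lemma srep_gen (S : srep -> Prop) : stable S -> S u -> forall x, S x.
Proof.
move=> [S0 SP SA SB] Su; apply: (simple_gen (S := S)) Su u_neq0 => //.
by apply: srep_act => // d d0 v; apply: SB.
Qed.

Lemma srep_words (x : srep) : neg_span (fun=> True) (eq (u : srep)) x.
Proof.
apply: (srep_gen (S := neg_span (fun=> True) (eq (u : srep)))); last first.
  by apply: (neg_span_word (w := [::])).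
have RA (d : int) t : 0 <= d -> u = t -> lspan (eq (u : srep)) (@opA _ srep d t).
  move=> d0 <-; case: (ltrgt0P d) d0 => // [d0 _|-> _].
    by rewrite srep_A //; left.
  by rewrite srep_hw; apply/lspanZ/lspan_mem.
have RB (d : int) t : 0 < d -> u = t -> lspan (eq (u : srep)) (@opB _ srep d t).
  by move=> d0 <-; rewrite srep_B //; left.
split; first by left.
- by move=> a y z; apply: lspanP.
- by move=> d y; apply: neg_span_stableA.
by move=> d y; apply: neg_span_stableB.
Qed.

Definition shw : hwrep C.
Proof.
apply: (@HwRep C srep u (hw_fun srep_words) h ha).
- exact: srep_B0.
- exact: (hw_fun_lin srep_hw srep_words u_neq0).
- exact: srep_A.
- exact: srep_B.
- exact: srep_hw.
- exact: (hw_funA srep_hw srep_words u_neq0).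
- exact: (hw_funB srep_hw srep_words u_neq0).
- exact: (hw_fun0 srep_hw srep_words u_neq0).
- exact: (hw_fun_u srep_hw srep_words u_neq0).
- exact: srep_gen.
(* A nonzero vector of a stable subspace generates [u], on which the functional takes the value
   1. *)
move=> S [S0 SP SA SB] Sf x Sx; apply/eqP/negPn/negP => x0.
suff /Sf/eqP : S u by rewrite (hw_fun_u srep_hw) // oner_eq0.
apply: (simple_gen (S := S)) Sx x0 u => //.
by apply: srep_act => // d d0 v; apply: SB.
Defined.

Lemma qchar_of_dims (f : fps) (dim : nat -> nat) : (forall n, f n = (dim n)%:Z) ->
  (forall n, exists e : 'I_(dim n) -> shw,
  [/\ forall i, levelspan n (e i),
      forall c : 'I_(dim n) -> C, \sum_i c i *: e i = 0 -> forall i, c i = 0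
    & forall x, levelspan n x -> exists c : 'I_(dim n) -> C, x = \sum_i c i *: e i]) ->
  has_qchar M (qseries h f).
Proof.
move=> fd dimP; split=> [x|lam].
  have [s [N [Ls sN]]] := level_decomp (srep_words x).
  exists N, (fun m => h + (val m)%:R / 2%:R), s; split; last exact: sN.
  by move=> m; rewrite /L0_eigen -/(act _ _) -srep_A0; apply: (neg_span_eigen srep_hw (Ls m)).
have eig (x : M) : L0_eigen lam x -> x != 0 ->
    exists2 n, lam = h + n%:R / 2%:R & levelspan n (x : shw).
  rewrite /L0_eigen -/(act _ _) -srep_A0 => xl x0.
  by have [n ln Lx] := eigen_level srep_hw srep_words xl x0; exists n.
have [[n ln]|nol] := pselect (exists n, lam = h + n%:R / 2%:R); last first.
  exists 0%N; last by rewrite qseries_out // => n ln; apply: nol; exists n.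
  exists (fun=> 0); split=> [[]//|c _ []//|x xl].
  exists (fun=> 0); rewrite big_ord0; apply/eqP/negPn/negP => x0.
  by have [n ln _] := eig x xl x0; apply: nol; exists n.
exists (dim n); last by rewrite ln qseriesE fd.
have [e [Le e_ind e_span]] := dimP n; exists e; split=> // [i|x xl].
  by rewrite /L0_eigen -/(act _ _) -srep_A0 ln; apply: (level_eigen (Le i)).
have [->|x0] := eqVneq x 0; first by apply: e_span; left.
have [m lm Lx] := eig x xl x0; apply: e_span.
by have -> : n = m; first by apply: (@lam_inj _ h); rewrite -ln.
Qed.

End SimpleModule.

(** * Generating functions *)

Section PowerSeries.
Implicit Types f g k : fps.

(** The n-th coefficient of a product depends only on the truncations at degree n, so the laws of
    multiplication are inherited from polynomials. *)
Let trunc_poly (n : nat) (f : fps) : {poly int} := \poly_(i < n.+1) f i.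

Let coef_trunc n f i : (i <= n)%N -> (trunc_poly n f)`_i = f i.
Proof. by move=> le_in; rewrite coef_poly ltnS le_in. Qed.

Let coef_truncM n f g i : (i <= n)%N -> (trunc_poly n f * trunc_poly n g)`_i = fps_mul f g i.
Proof.
move=> le_in; rewrite coefM; apply: eq_bigr => j _.
have ji : (j <= i)%N by rewrite -ltnS.
by rewrite !coef_trunc // ?(leq_trans (leq_subr _ _)) // (leq_trans ji).
Qed.

Lemma fps_mulC : commutative fps_mul.
Proof. by move=> f g; apply/funext => n; rewrite -!(coef_truncM _ _ (leqnn n)) mulrC. Qed.

Lemma fps_mulA : associative fps_mul.
Proof.
move=> f g k; apply/funext => n.
have -> : fps_mul f (fps_mul g k) n = (trunc_poly n f * (trunc_poly n g * trunc_poly n k))`_n.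
  rewrite coefM; apply: eq_bigr => j _; have jn : (j <= n)%N by rewrite -ltnS.
  by rewrite coef_trunc // coef_truncM // leq_subr.
rewrite mulrA coefM; apply: eq_bigr => j _; have jn : (j <= n)%N by rewrite -ltnS.
by rewrite coef_truncM // coef_trunc // leq_subr.
Qed.

Lemma fps_mono_mul m f n :
  fps_mul (fps_mono m) f n = if (m <= n)%N then f (n - m)%N else 0.
Proof.
rewrite /fps_mul /fps_mono; case: leqP => mn; last first.
  rewrite big1 // => i _; have im : (i < m)%N by apply: leq_ltn_trans mn; rewrite -ltnS.
  by rewrite (ltn_eqF im) mul0r.
have lt_m : (m < n.+1)%N by [].
rewrite (bigD1 (Ordinal lt_m)) //= eqxx mul1r big1 ?addr0 // => i.
by rewrite -val_eqE /= => /negPf ->; rewrite mul0r.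
Qed.

Lemma fps_mul1 : left_id fps_one fps_mul.
Proof. by move=> f; apply/funext => n; rewrite (fps_mono_mul 0) subn0. Qed.

HB.instance Definition _ := Monoid.isComLaw.Build fps fps_one fps_mul
  fps_mulA fps_mulC fps_mul1.

Lemma fps_mulACA : interchange fps_mul fps_mul.
Proof. exact: Monoid.mulmACA. Qed.

Lemma fps_mulDl f g k : fps_mul (fps_add f g) k = fps_add (fps_mul f k) (fps_mul g k).
Proof.
apply/funext => n; rewrite /fps_mul /fps_add -big_split /=.
by apply: eq_bigr => i _; rewrite mulrDl.
Qed.

Lemma fps_mulBl f g k : fps_mul (fps_sub f g) k = fps_sub (fps_mul f k) (fps_mul g k).
Proof.
apply/funext => n; rewrite /fps_mul /fps_sub -sumrB.
by apply: eq_bigr => i _; rewrite mulrBl.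
Qed.

Lemma fps_mulV f : f 0%N = 1 -> fps_mul f (fps_inv f) = fps_one.
Proof. by move=> f0; rewrite fps_mulC; apply/funext/fps_mulVf. Qed.

Lemma fps_inv_uniq f g : f 0%N = 1 -> fps_mul f g = fps_one -> g = fps_inv f.
Proof.
move=> f0 fg; rewrite -[LHS]fps_mul1 -(fps_mulV f0) [fps_mul f _]fps_mulC -fps_mulA fg.
by rewrite fps_mulC fps_mul1.
Qed.

Lemma fps_invM f g : f 0%N = 1 -> g 0%N = 1 ->
  fps_inv (fps_mul f g) = fps_mul (fps_inv f) (fps_inv g).
Proof.
move=> f0 g0; apply/esym/fps_inv_uniq.
  by rewrite /fps_mul big_ord1 f0 g0.
by rewrite fps_mulACA !fps_mulV // fps_mul1.
Qed.

(** The series of the possible multiplicities of a part d: at most one if d is odd, any number if d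
    is even. *)
Definition part_factor (d : nat) : fps :=
  if odd d then fps_add fps_one (fps_mono d) else fps_inv (fps_sub fps_one (fps_mono d)).

Lemma one_sub_mono0 d : (0 < d)%N -> fps_sub fps_one (fps_mono d) 0%N = 1.
Proof. by case: d => // d _; rewrite /fps_sub /fps_one /fps_mono subr0. Qed.

Definition parts_gf (P : pred nat) (N : nat) : fps := fun n => (size (parts P N n))%:Z.

Lemma parts_gfS P N : parts_gf P N.+1 =
  if P N.+1 then fps_mul (part_factor N.+1) (parts_gf P N) else parts_gf P N.
Proof.
have E n : parts_gf P N.+1 n = parts_gf P N n +
    (if P N.+1 && (N < n)%N then
       parts_gf P (if odd N.+1 then N else N.+1) (n - N.+1)%N else 0).
  rewrite /parts_gf size_partsS; case: ifP => _; first by rewrite PoszD.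
  by rewrite addn0 addr0.
case PN: (P N.+1) in E *; last by apply/funext => n; rewrite E addr0.
rewrite /part_factor; case oN: (odd N.+1) in E *.
  apply/funext => n; rewrite fps_mulDl fps_mul1 /fps_add fps_mono_mul E.
  by [].
(* For an even part the recursion refers to the new series itself; it is solved in the form g_N = (1
   - t^(N+1)) g_(N+1). *)
have -> : parts_gf P N = fps_mul (fps_sub fps_one (fps_mono N.+1)) (parts_gf P N.+1).
  apply/funext => n; rewrite fps_mulBl fps_mul1 /fps_sub fps_mono_mul {1}E.
  by rewrite addrK.
by rewrite fps_mulA [fps_mul (fps_inv _) _]fps_mulC fps_mulV ?one_sub_mono0 // fps_mul1.
Qed.

Lemma parts_gfE P N : parts_gf P N =
  \big[fps_mul/fps_one]_(1 <= d < N.+1 | P d) part_factor d.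
Proof.
elim: N => [|N IH].
  rewrite big_geq //; apply/funext => n.
  by rewrite /parts_gf size_parts0 /fps_one; case: eqP.
rewrite parts_gfS big_mkcond big_nat_recr //= -big_mkcond -IH /=.
by rewrite fps_mulC; case: (P N.+1); rewrite // fps_mulC fps_mul1.
Qed.

(** With t = q^(1/2), the parts 2k-1 and 2k contribute 1 + q^(k-1/2) and 1/(1 - q^k). The square
    accounts for the two families of letters A and B. *)
Lemma char_prod K : fps_prod_upto char_factor K =
  fps_mul (parts_gf predT (2 * K)) (parts_gf predT (2 * K)).
Proof.
elim: K => [|K IH].
  have -> : parts_gf predT (2 * 0) = fps_one by rewrite parts_gfE big_geq.
  by rewrite fps_mul1.
rewrite [LHS]/= IH mulnS !parts_gfS /= /char_factor mulnS.
have -> : (2 + 2 * K - 1 = (2 * K).+1)%N by lia.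
set F := parts_gf _ _; rewrite add2n.
set a := fps_add _ _; set b := fps_sub _ _.
have -> : part_factor (2 * K).+1 = a by rewrite /part_factor /= oddM.
have -> : part_factor (2 * K).+2 = fps_inv b by rewrite /part_factor /= oddM.
rewrite fps_invM ?one_sub_mono0 //; move: (fps_inv b) => c.
rewrite (fps_mulA c a F) (fps_mulACA (fps_mul c a) F) (fps_mulACA c a).
by rewrite [LHS]fps_mulC [fps_mul (fps_mul a a) _]fps_mulC.
Qed.

(** The d > 0 with w(d) = 0 or, when the parameter of the module is negative, with w(-d) = 0; here
    [p] is the absolute value of that parameter. *)
Definition bad_part (p : nat) : pred nat :=
  fun d => (d == p) && odd p || (d == 2 * p)%N.

Lemma bad_gf (p N : nat) : (0 < p)%N -> (2 * p <= N)%N ->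
  parts_gf (predC (bad_part p)) N =
  fps_mul (fps_sub fps_one (fps_mono (if odd p then p else 2 * p)%N)) (parts_gf predT N).
Proof.
move=> p0 pN; set g := fps_sub _ _.
pose B := \big[fps_mul/fps_one]_(1 <= d < N.+1 | bad_part p d) part_factor d.
have FB : parts_gf predT N = fps_mul B (parts_gf (predC (bad_part p)) N).
  by rewrite !parts_gfE (bigID (bad_part p)).
suff gB : fps_mul g B = fps_one by rewrite FB fps_mulA gB fps_mul1.
have in2p : (2 * p)%N \in index_iota 1 N.+1 by rewrite mem_index_iota; lia.
have bad2p : bad_part p (2 * p) by rewrite /bad_part eqxx orbT.
have f2p : part_factor (2 * p) = fps_inv (fps_sub fps_one (fps_mono (2 * p))).
  by rewrite /part_factor oddM.
have p20 : (0 < 2 * p)%N by lia.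
have ur : uniq (index_iota 1 N.+1) by apply: iota_uniq.
have mr d : d \in rem (2 * p)%N (index_iota 1 N.+1) ->
    d != (2 * p)%N by rewrite mem_rem_uniq // inE => /andP[].
rewrite /B (big_rem _ in2p) /= bad2p f2p.
case op: (odd p) @g => g; last first.
  rewrite big1_seq.
    by rewrite [fps_mul _ fps_one]fps_mulC fps_mul1 fps_mulV //; apply: one_sub_mono0.
  by move=> d /andP[]; rewrite /bad_part op andbF /= => /eqP -> /mr; rewrite eqxx.
have inp : p \in rem (2 * p)%N (index_iota 1 N.+1).
  by rewrite mem_rem_uniq // inE mem_index_iota; lia.
rewrite (big_rem _ inp) /= {1}/bad_part eqxx op /=.
rewrite big1_seq; last first.
  move=> d /andP[]; rewrite /bad_part => /orP[/andP[/eqP -> _]|/eqP ->].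
    by rewrite mem_rem_uniq ?rem_uniq // inE eqxx.
  by move/mem_rem/mr; rewrite eqxx.
rewrite [fps_mul _ fps_one]fps_mulC fps_mul1 /part_factor op.
rewrite [fps_mul (fps_inv _) _]fps_mulC fps_mulA.
(* (1 - t^p)(1 + t^p) = 1 - t^(2p), the denominator contributed by the part 2p. *)
have -> : fps_mul g (fps_add fps_one (fps_mono p)) = fps_sub fps_one (fps_mono (2 * p)).
  apply/funext => n; rewrite fps_mulC fps_mulDl fps_mul1 /fps_add fps_mono_mul.
  rewrite /g /fps_sub /fps_one /fps_mono; case: leqP => pn; last first.
    rewrite addr0 (ltn_eqF pn) (ltn_eqF (_ : n < 2 * p)%N) //; lia.
  have -> : (n - p == 0)%N = (n == p) by lia.
  have -> : (n - p == p)%N = (n == 2 * p)%N by lia.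
  by rewrite addrA subrK.
by rewrite fps_mulV ?one_sub_mono0.
Qed.

Lemma parts_gf_bound P N n : (n <= N)%N -> parts_gf P N n = (size (parts P n n))%:Z.
Proof. by move=> nN; rewrite /parts_gf size_parts_bound. Qed.

Lemma size_basis_gf (p n : nat) : (0 < p)%N ->
  fps_mul (fps_sub fps_one (fps_mono (if odd p then p else 2 * p)%N))
    (fps_prod char_factor) n = (size (basis (bad_part p) n))%:Z.
Proof.
(* Large enough for the partial product to be exact in degree [n], and for the part 2p not to exceed
   the bound 2K. *)
move=> p0; pose K := (n + p)%N.
have -> : fps_mul (fps_sub fps_one (fps_mono (if odd p then p else 2 * p)%N))
    (fps_prod char_factor) n =
  fps_mul (fps_sub fps_one (fps_mono (if odd p then p else 2 * p)%N))
    (fps_prod_upto char_factor K) n.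
  apply: eq_bigr => i _; congr (_ * _); apply/esym/fps_prod_lim.
    exact: char_factor_near_one.
  by rewrite /K; lia.
rewrite char_prod fps_mulA -bad_gf //; last by rewrite /K; lia.
rewrite fps_mulC size_basis -[RHS]natz natr_sum; apply: eq_bigr => i _.
have iK : (i <= 2 * K)%N by have := ltn_ord i; rewrite /K; lia.
by rewrite natrM !natz !parts_gf_bound //; rewrite /K; lia.
Qed.

End PowerSeries.

(** * The zeros of [w] and the character formula *)

Lemma fcw_eq0 (R : realType) (cLA : R[i]) (p d : int) : cLA != 0 ->
  (fcw cLA ((1 + p%:~R) * cLA) d == 0) = 
  (d == 0) || (if oddz d then d == p else d == 2 * p).
Proof.
move=> c0; rewrite /fcw; elim/parity_ind: d => m.
  rewrite oddz2 half2; set mC : R[i] := m%:~R.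
  have -> : mC * ((1 + p%:~R) * cLA) - (mC ^+ 2 + mC) * cLA =
     mC * (cLA * (p - m)%:~R) by rewrite rmorphB /= -/mC; ring.
  rewrite !mulf_eq0 (negPf c0) /mC !intr_eq0 /=; lia.
rewrite oddz21 half21; set mC : R[i] := m%:~R.
have -> : (1 + p%:~R) * cLA - 2%:R * (mC + 1) * cLA =
   cLA * (p - (2 * m + 1))%:~R.
  by rewrite rmorphB rmorphD rmorphM /= -/mC; ring.
rewrite !mulf_eq0 (negPf c0) !intr_eq0 /=; lia.
Qed.

Lemma simple_qchar (R : realType) (cL cLA h : R[i]) (p : int) (M : shModule R) (u : M) :
  cLA != 0 -> p != 0 -> sh_hwv cL cLA h ((1 + p%:~R) * cLA) u -> u != 0 ->
  sh_simple M ->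
  has_qchar M (qseries h (fps_mul
    (fps_sub fps_one (fps_mono (if odd `|p|%N then `|p|%N else 2 * `|p|)%N))
    (fps_prod char_factor))).
Proof.
move=> c0 p0 hu u0 Ms; have p0' : (0 < `|p|)%N by rewrite absz_gt0.
apply: (qchar_of_dims (u_hwv := hu) (u_neq0 := u0) (M_simple := Ms)
  (dim := fun n => size (basis (bad_part `|p|) n))).
  by move=> n; apply: size_basis_gf.
have cwE d : cw (shw hu u0 Ms) d = fcw cLA ((1 + p%:~R) * cLA) d by [].
move=> n; case: (ltP 0 p) => pp; [apply: level_dim|apply: level_dim_dual] => d d0;
  rewrite cwE fcw_eq0 // /oddz /bad_part; case: ifP; lia.
Qed.

Theorem theorem1p1 (R : realType) (cL cLA : R[i]) (hcLA : cLA != 0)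
    (p : int) (hp : p != 0) (r : R[i])
    (V : shModule R) (v : V)
    (hV : is_verma cL cLA (h_pr cL p r) ((1 + p%:~R) * cLA) v)
    (M : shModule R) (pi : V -> M) (hM : is_simple_quotient pi) :
  (odd `|p|%N ->
    has_qchar M
      (qseries (h_pr cL p r)
        (fps_mul (fps_sub fps_one (fps_mono `|p|%N))
                 (fps_prod char_factor)))) /\
  (~~ odd `|p|%N ->
    has_qchar M
      (qseries (h_pr cL p r)
        (fps_mul (fps_sub fps_one (fps_mono (2 * `|p|%N)))
                 (fps_prod char_factor)))).
Proof.
case: hM => -[pi_lin pi_act] pi_surj Ms.
have pi0 : pi 0 = 0 by have := pi_lin (-1) 0 0; rewrite scaler0 addr0 scaleN1r addNr.
have piZ a x : pi (a *: x) = a *: pi x by rewrite -[a *: x]addr0 pi_lin pi0 addr0.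
have [v_hwv v_gen _] := hV; have [[vL vA vLA] v_pos v_L0 v_A0] := v_hwv.
have u_hwv : sh_hwv cL cLA (h_pr cL p r) ((1 + p%:~R) * cLA) (pi v).
  split.
  - split=> w; have [x <-] := pi_surj w; rewrite -pi_act.
    + by rewrite vL piZ.
    + by rewrite vA.
    by rewrite vLA piZ.
  - by move=> x px; rewrite -pi_act v_pos.
  - by rewrite -pi_act v_L0 piZ.
  by rewrite -pi_act v_A0 piZ.
(* Otherwise the kernel of [pi] would be a submodule containing the generator [v], and [M] would be
   zero. *)
have u0 : pi v != 0.
  apply/eqP => piv; have [[m /eqP m0] _] := Ms; apply: m0.
  have [x <-] := pi_surj m; apply: (v_gen (fun x => pi x = 0)) => //; split=> //.
    by move=> a y z; rewrite pi_lin => -> ->; rewrite scaler0 addr0.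
  move=> y z; rewrite pi_act => ->.
  by apply: (linear_map0 (f := fun w : M => sh_act y w)) => a s t; apply: sh_act_linr.
have := simple_qchar hcLA hp u_hwv u0 Ms.
by case: (odd `|p|%N).
Qed.
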